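(* Let $G$ be a countable amenable group with identity $e$ and let $F=(F_N)_{N\in\mathbb{N}}$ be any Følner sequence in $G$. A set $H\subseteq G\setminus\{e\}$ is a set of nice recurrence if and only if it is nicely $F$-intersective.
   Context: A (left) Følner sequence in a countable group $G$ is a sequence $F=(F_N)_{N\in\mathbb{N}}$ of (nonempty) finite subsets of $G$ such that $\lim_{N\to\infty}\frac{|gF_N\Delta F_N|}{|F_N|}=0$ for all $g\in G$; $G$ is (left) amenable if it has a Følner sequence. For $E\subseteq G$, $\overline{d}_F(E):=\limsup_{N\to\infty}\frac{|E\cap F_N|}{|F_N|}$. A measure preserving system $(X,\mathcal{B},\mu,(T_g)_{g\in G})$ is a probability space together with an action $(T_g)_{g\in G}$ of $G$ on $X$ by measure preserving maps. For a family of reals $(x_h)_{h\in H}$, $\limsup_{h\in H}x_h:=\inf_{H_0\subseteq H\text{ finite}}\ \sup_{h\in H\setminus H_0}x_h$. A set $H\subseteq G$ is a set of nice recurrence if for every measure preserving system $(X,\mathcal{B},\mu,(T_g)_{g\in G})$ and every $B\in\mathcal{B}$, $\mu(B)^2\leq\limsup_{h\in H}\mu(B\cap T_hB)$. A set $H\subseteq G$ is nicely $F$-intersective if for all $E\subseteq G$ and $\varepsilon>0$ there is some $g\in H$ such that $\overline{d}_F(E\cap gE)>\overline{d}_F(E)^2-\varepsilon$. *)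

(* Defs.v *)
From HB Require Import structures.
From mathcomp Require Import all_boot all_order all_algebra finmap.
From mathcomp Require Import all_classical all_reals all_analysis.
Set Implicit Arguments.
Unset Strict Implicit.
Unset Printing Implicit Defensive.
Import Order.TTheory GRing.Theory Num.Theory.
Import numFieldNormedType.Exports.
Local Open Scope classical_set_scope.
Local Open Scope ring_scope.

Definition ltranslate (G : groupType) (g : G) (E : set G) : set G :=
  [set (g * x)%g | x in E].

Definition fset_ltranslate (G : groupType) (g : G) (A : {fset G}) : {fset G} :=
  [fset (g * x)%g | x in A]%fset.

Definition fset_symdiff (T : choiceType) (A B : {fset T}) : {fset T} :=
  ((A `\` B) `|` (B `\` A))%fset.

Definition folner_sequence (R : realType) (G : groupType)
    (F : nat -> {fset G}) : Prop :=
  (forall N, F N != fset0) /\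
  (forall g : G,
     (fun N => #|` fset_symdiff (fset_ltranslate g (F N)) (F N)|%:R
               / #|` F N|%:R : R) @ \oo --> (0 : R)).

Definition amenable (R : realType) (G : groupType) : Prop :=
  exists F : nat -> {fset G}, folner_sequence R F.

Definition upper_density (R : realType) (G : groupType) (F : nat -> {fset G})
    (E : set G) : \bar R :=
  limn_esup (fun N =>
    (#|` [fset x in F N | x \in E]%fset|%:R / #|` F N|%:R)%:E).

(* The supremum over the empty family is -oo; in particular the limsup over a
   finite H is -oo. *)
Definition limsup_family (R : realType) (I : Type) (H : set I)
    (x : I -> \bar R) : \bar R :=
  ereal_inf [set ereal_sup (x @` (H `\` H0))
            | H0 in [set H0 : set I | finite_set H0 /\ H0 `<=` H]].

Record mp_action (R : realType) (G : groupType) (d : measure_display)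
    (X : measurableType d) (mu : probability X R) (T : G -> X -> X) : Prop := {
  mp_action1 : forall x, T 1%g x = x ;
  mp_actionM : forall g h x, T (g * h)%g x = T g (T h x) ;
  mp_action_measurable : forall g, measurable_fun [set: X] (T g) ;
  mp_action_preserving : forall g (A : set X),
    measurable A -> mu (T g @^-1` A) = mu A }.

Definition nice_recurrence (R : realType) (G : groupType) (H : set G) : Prop :=
  forall (d : measure_display) (X : measurableType d) (mu : probability X R)
    (T : G -> X -> X), mp_action mu T ->
  forall B : set X, measurable B ->
    (mu B ^+ 2 <= limsup_family H (fun h => mu (B `&` T h @` B)))%E.

Definition nicely_intersective (R : realType) (G : groupType)
    (F : nat -> {fset G}) (H : set G) : Prop :=
  forall (E : set G) (eps : R), 0 < eps ->
    exists2 g, H g &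
      (upper_density R F (E `&` ltranslate g E) >
       upper_density R F E ^+ 2 - eps%:E)%E.

(* Main.v *)
Require Import Defs.
From HB Require Import structures.
From mathcomp Require Import all_boot all_order all_algebra finmap.
From mathcomp Require Import all_classical all_reals all_analysis.
From mathcomp Require Import ring lra.
Set Implicit Arguments.
Unset Strict Implicit.
Unset Printing Implicit Defensive.
Import Order.TTheory GRing.Theory Num.Theory.
Import numFieldNormedType.Exports.
Local Open Scope classical_set_scope.
Local Open Scope ring_scope.

(** Recurrence implies intersectivity by Furstenberg's correspondence: an
    ultrafilter limit of the densities along [F] is an invariant mean on the
    subsets of [G]; transported to the cylinder sets of [G -> bool] it extends to
    a shift-invariant probability.

    Conversely, let [mu (B & T_h B) <= mu B ^ 2 - delta] for all [h] in [H]
    outside a finite set [H0].  For each finite part of [H], independent random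
    points of [X], placed at sparse random centers and read along the surrounding
    Folner windows, give a random subset of [G] of density [b] in which every [h] of the part has pair
    correlation at most [b ^ 2 - eps], with [b] and [eps] independent of the part;
    thinning by independent bits handles [H0].  The Lovasz local lemma makes such
    a set deterministic, with averages controlled uniformly over all right
    translates of a finite window, hence along any Folner sequence.  Finally the
    sets obtained for larger and larger parts of [H] are joined by slow
    interpolation and glued along an exhaustion of [G] adapted to [F]. *)

(** * Product expectations *)

(** [F] is arbitrary, and along it ergodic averages need not converge pointwise, so the set cannot
    be read off one orbit; independent points replace the orbit. Control of one finite window at all
    right translates suffices, because a left almost invariant set is, on average, composed of such
    translates. Two points of [G] with a common center save [delta]; with different centers their
    readings are independent and nothing is lost. Common centers have frequency at least 1/16,
    whence the factor 1/16 in [eps]. Nothing is known about the elements of [H0], so thinning makes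
    the correlations there negligible; it multiplies the density by [p = 4^-1 ^+ size H0] and the
    other correlations by exactly [p ^ 2], so the gap below the squared density survives. Gluing
    cannot be abrupt: one [F N] may meet several shells, and correlations between unrelated sets
    across a boundary are not controlled. Interpolation makes consecutive stages differ rarely, so
    boundedly many shells act as one set. Finite [G] is settled apart, since the probabilistic part
    needs windows with arbitrarily many points. *)

Section Expectation.
Variables (R : realType) (V : choiceType) (A : finType) (w : A -> R).
Hypotheses (w_ge0 : forall a, 0 <= w a) (w_sum1 : \sum_a w a = 1).
Implicit Types (F H : (V -> A) -> R) (z : V -> A) (v : V) (vs : seq V).

Definition upd z v a : V -> A := fun u => if u == v then a else z u.

Definition avg1 v F : (V -> A) -> R := fun z => \sum_a w a * F (upd z v a).

(** [V] may be infinite, but only finitely many coordinates are ever integrated, so no measure on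
    [V -> A] is built; [z] supplies the coordinates outside [vs]. *)
Definition Ex vs F : (V -> A) -> R := foldr avg1 F vs.

Definition indep T v (F : (V -> A) -> T) := forall z a, F (upd z v a) = F z.

Definition local (D : seq V) T (F : (V -> A) -> T) :=
  forall z z', {in D, z =1 z'} -> F z = F z'.

Lemma upd_same z v a : upd z v a v = a.
Proof. by rewrite /upd eqxx. Qed.

Lemma upd_other z v a u : u != v -> upd z v a u = z u.
Proof. by rewrite /upd => /negbTE ->. Qed.

Lemma updC z u v a b : u != v ->
  upd (upd z v a) u b = upd (upd z u b) v a.
Proof.
move=> uv; apply/funext => x; rewrite /upd.
case: eqVneq => [->|//]; by rewrite (negbTE uv).
Qed.

Lemma upd_upd z v a b : upd (upd z v a) v b = upd z v b.
Proof. by apply/funext => x; rewrite /upd; case: eqP. Qed.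

Lemma local_indep (D : seq V) T (F : (V -> A) -> T) v : local D F -> v \notin D -> indep v F.
Proof.
move=> lF vD z a; apply: lF => u uD; rewrite upd_other //.
by apply: contraNneq vD => <-.
Qed.

Lemma eq_Ex vs F H z : F =1 H -> Ex vs F z = Ex vs H z.
Proof. by move=> /funext ->. Qed.

Lemma Ex_le vs F H z : (forall z, F z <= H z) -> Ex vs F z <= Ex vs H z.
Proof.
move=> FH; elim: vs z => [//|v vs IH] z /=.
by apply: ler_sum => a _; apply: ler_wpM2l.
Qed.

Lemma avg1_const v c z : avg1 v (fun=> c) z = c.
Proof. by rewrite /avg1 -mulr_suml w_sum1 mul1r. Qed.

Lemma Ex_const vs c z : Ex vs (fun=> c) z = c.
Proof.
elim: vs z => [//|v vs IH] z /=; rewrite -[RHS](avg1_const v c z).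
by apply: eq_bigr => a _; rewrite IH.
Qed.

Lemma Ex_ge0 vs F z : (forall z, 0 <= F z) -> 0 <= Ex vs F z.
Proof. by move=> F0; rewrite -(Ex_const vs 0 z); exact: Ex_le. Qed.

Lemma ExD vs F H z : Ex vs (fun z => F z + H z) z = Ex vs F z + Ex vs H z.
Proof.
elim: vs z => [//|v vs IH] z /=; rewrite /avg1 -big_split /=.
by apply: eq_bigr => a _; rewrite IH mulrDr.
Qed.

Lemma ExZ vs c F z : Ex vs (fun z => c * F z) z = c * Ex vs F z.
Proof.
elim: vs z => [//|v vs IH] z /=; rewrite /avg1 mulr_sumr.
by apply: eq_bigr => a _; rewrite IH mulrCA.
Qed.

Lemma ExN vs F z : Ex vs (fun z => - F z) z = - Ex vs F z.
Proof. by rewrite -mulN1r -ExZ; apply: eq_Ex => x; rewrite mulN1r. Qed.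

Lemma Ex_sum I (r : seq I) vs (F : I -> (V -> A) -> R) z :
  Ex vs (fun z => \sum_(i <- r) F i z) z = \sum_(i <- r) Ex vs (F i) z.
Proof.
elim: r => [|i r IH].
  rewrite big_nil -[RHS](Ex_const vs 0 z).
  by apply: eq_Ex => x; rewrite big_nil.
rewrite big_cons -IH -ExD.
by apply: eq_Ex => x; rewrite big_cons.
Qed.

Lemma indep_Ex vs v F : indep v F -> indep v (Ex vs F).
Proof.
move=> iF; elim: vs => [//|u vs IH] z a /=; rewrite /avg1.
apply: eq_bigr => b _; congr (_ * _).
have [->|uv] := eqVneq u v; first by rewrite upd_upd.
by rewrite updC // IH.
Qed.

Lemma avg1_indep v F z : indep v F -> avg1 v F z = F z.
Proof.
move=> iF; rewrite /avg1 -[RHS]mul1r -w_sum1 mulr_suml.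
by apply: eq_bigr => a _; rewrite iF.
Qed.

(** At each coordinate [v] one factor does not see [v], also after the other coordinates are
    averaged ([indep_Ex]), and leaves the average at [v] as a constant. *)
Lemma Ex_mul vs F H z : (forall v, v \in vs -> indep v F \/ indep v H) ->
  Ex vs (fun z => F z * H z) z = Ex vs F z * Ex vs H z.
Proof.
elim: vs z => [//|v vs IH] z ivs /=.
transitivity (avg1 v (fun z => Ex vs F z * Ex vs H z) z).
  apply: eq_bigr => a _; rewrite IH // => u uvs.
  by apply: ivs; rewrite inE uvs orbT.
have [iF|iH] := ivs v (mem_head _ _).
  rewrite (avg1_indep z (indep_Ex vs iF)) /avg1 mulr_sumr.
  by apply: eq_bigr => a _; rewrite (indep_Ex vs iF) mulrCA.
rewrite (avg1_indep z (indep_Ex vs iH)) /avg1 mulr_suml.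
by apply: eq_bigr => a _; rewrite (indep_Ex vs iH) mulrA.
Qed.

Lemma Ex_coord vs v (k : A -> R) z : v \in vs ->
  Ex vs (fun z => k (z v)) z = \sum_a w a * k a.
Proof.
have cst us c x : (forall y, Ex us (fun z => k (z v)) y = c) ->
    avg1 x (Ex us (fun z => k (z v))) z = c.
  by move=> e; rewrite -(avg1_const x c z); apply: eq_bigr => a _; rewrite e.
elim: vs z cst => [//|u vs IH] z cst; rewrite inE => vuvs /=.
have [vvs|vNvs] := boolP (v \in vs).
  apply: cst => y; apply: IH => // us c x e.
  by rewrite -(avg1_const x c y); apply: eq_bigr => a _; rewrite e.
move: vuvs; rewrite (negbTE vNvs) orbF => /eqP <-.
apply: eq_bigr => a _; congr (_ * _).
transitivity (Ex vs (fun=> k a) (upd z v a)); last exact: Ex_const.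
have {}vNvs : v \notin vs by [].
have ind us : v \notin us ->
    forall y, y v = a -> Ex us (fun z => k (z v)) y = k a.
  elim: us => [|x us IHu] /=; first by move=> _ y ->.
  rewrite inE negb_or => /andP[vx vus] y ya.
  rewrite -(avg1_const x (k a) y); apply: eq_bigr => b _.
  by rewrite IHu // upd_other.
by rewrite ind ?upd_same // Ex_const.
Qed.

Lemma Ex_coordM vs v (k : A -> R) H z : v \in vs -> indep v H ->
  Ex vs (fun z => k (z v) * H z) z = (\sum_a w a * k a) * Ex vs H z.
Proof.
move=> vvs iH; rewrite -(Ex_coord k z vvs); apply: Ex_mul => u _.
have [->|uv] := eqVneq u v; [by right|left => x a].
by rewrite upd_other // eq_sym.
Qed.

(** From [expR y <= (1 - y)^-1]; what remains amounts to [0 <= y ^+ 2 * (1 - 2 * y)]. *)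
Lemma expR_le_quad (y : R) : `|y| <= 2^-1 -> expR y <= 1 + y + 2 * y ^+ 2.
Proof.
rewrite ler_norml => /andP[y1 y2].
have yp : 0 < 1 - y by lra.
have : expR y <= (1 - y)^-1.
  rewrite -[expR y]invrK -expRN lef_pV2 ?posrE ?expR_gt0 //.
  exact: expR_ge1Dx.
move/le_trans; apply; rewrite -div1r ler_pdivrMr //.
have : 0 <= y ^+ 2 * (1 - 2 * y) by rewrite mulr_ge0 ?sqr_ge0 //; lra.
lra.
Qed.

(** Once the mean is factored out, the linear term of the exponential averages to zero, and the
    quadratic one is at most [2 * (l * b) ^+ 2] since every value is within [b] of the mean. *)
Lemma avg1_mgf v F z (l b : R) : 0 <= l -> 0 <= b -> l * b <= 2^-1 ->
  (forall a a', F (upd z v a) - F (upd z v a') <= b) ->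
  avg1 v (fun z => expR (l * F z)) z <=
  expR (2 * (l * b) ^+ 2) * expR (l * avg1 v F z).
Proof.
move=> l0 b0 lb osc; set m := avg1 v F z.
have dev a : `|F (upd z v a) - m| <= b.
  have -> : F (upd z v a) - m =
      \sum_a' w a' * (F (upd z v a) - F (upd z v a')).
    under eq_bigr do rewrite mulrBr.
    by rewrite sumrB -mulr_suml w_sum1 mul1r.
  apply: le_trans (ler_norm_sum _ _ _) _.
  rewrite -[leRHS]mul1r -w_sum1 mulr_suml; apply: ler_sum => a' _.
  rewrite normrM ger0_norm // ler_wpM2l // ler_norml osc andbT.
  by rewrite -lerN2 opprK opprB osc.
have -> : avg1 v (fun z => expR (l * F z)) z =
    expR (l * m) * \sum_a w a * expR (l * (F (upd z v a) - m)).
  rewrite mulr_sumr; apply: eq_bigr => a _.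
  rewrite mulrCA -expRD; congr (_ * expR _); ring.
rewrite mulrC ler_wpM2r ?expR_ge0 //.
apply: (@le_trans _ _ (\sum_a w a *
    (1 + l * (F (upd z v a) - m) + 2 * (l * b) ^+ 2))).
  apply: ler_sum => a _; apply: ler_wpM2l => //.
  have la : `|l * (F (upd z v a) - m)| <= l * b.
    by rewrite normrM ger0_norm // ler_wpM2l.
  apply: le_trans (expR_le_quad (le_trans la lb)) _.
  rewrite lerD2l ler_pM2l // -real_normK ?num_real //.
  by rewrite lerXn2r ?nnegrE ?mulr_ge0.
have -> : \sum_a w a * (1 + l * (F (upd z v a) - m) + 2 * (l * b) ^+ 2) =
    \sum_a (w a * (1 - l * m + 2 * (l * b) ^+ 2) + l * (w a * F (upd z v a))).
  by apply: eq_bigr => a _; ring.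
rewrite big_split /= -mulr_suml -mulr_sumr -/(avg1 v F z) -/m.
rewrite w_sum1 mul1r addrAC subrK.
exact: expR_ge1Dx.
Qed.

Lemma Ex_osc vs v F (b : R) : v \notin vs ->
  (forall z a a', F (upd z v a) - F (upd z v a') <= b) ->
  forall z a a', Ex vs F (upd z v a) - Ex vs F (upd z v a') <= b.
Proof.
move=> vvs osc; elim: vs vvs => [//|u vs IH] /=.
rewrite inE negb_or => /andP[vu vvs] z a a'.
rewrite /avg1 -sumrB -[leRHS]mul1r -w_sum1 mulr_suml.
apply: ler_sum => c _; rewrite -mulrBr ler_wpM2l //.
by rewrite !(@updC _ u) 1?eq_sym // IH.
Qed.

(* The method of bounded differences; only the coordinates in [D] are counted. *)
Lemma Ex_mgf vs (D : seq V) F (l b : R) : uniq vs -> 0 <= l -> 0 <= b -> l * b <= 2^-1 ->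
  (forall v, v \notin D -> indep v F) ->
  (forall v z a a', F (upd z v a) - F (upd z v a') <= b) ->
  forall z, Ex vs (fun z => expR (l * F z)) z <=
    expR (2 * (l * b) ^+ 2 * (count (mem D) vs)%:R) * expR (l * Ex vs F z).
Proof.
move=> + l0 b0 lb iF osc; elim: vs => [_ z|v vs IH] /=.
  by rewrite mulr0 expR0 mul1r.
move=> /andP[vvs uvs] z.
apply: (@le_trans _ _ (avg1 v (fun z =>
    expR (2 * (l * b) ^+ 2 * (count (mem D) vs)%:R) *
    expR (l * Ex vs F z)) z)).
  by apply: ler_sum => a _; rewrite ler_wpM2l // IH.
have -> : avg1 v (fun z => expR (2 * (l * b) ^+ 2 * (count (mem D) vs)%:R) *
      expR (l * Ex vs F z)) z =
    expR (2 * (l * b) ^+ 2 * (count (mem D) vs)%:R) *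
    avg1 v (fun z => expR (l * Ex vs F z)) z.
  by rewrite /avg1 mulr_sumr; apply: eq_bigr => a _; rewrite mulrCA.
rewrite natrD mulrDr expRD [expR _ * expR _]mulrC -[leRHS]mulrA.
apply: ler_wpM2l; first exact: expR_ge0.
have [vD|vD] /= := boolP (v \in D).
  rewrite mulr1; apply: avg1_mgf => // a a'.
  exact: Ex_osc.
have ivs : indep v (Ex vs F) by apply/indep_Ex/iF.
rewrite mulr0 expR0 mul1r.
rewrite [X in _ <= expR (_ * X)](avg1_indep _ ivs) /avg1.
under eq_bigr do rewrite ivs.
by rewrite -mulr_suml w_sum1 mul1r.
Qed.

End Expectation.

(** * The local lemma *)

Section LocalLemma.
Variables (R : realType) (Z : Type) (Pr : (Z -> bool) -> R).
Hypotheses (Pr_ge0 : forall P, 0 <= Pr P)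
  (Pr_true : 0 < Pr (fun=> true))
  (Pr_split : forall P Q,
     Pr P = Pr (fun z => P z && Q z) + Pr (fun z => P z && ~~ Q z)).
Variables (I : eqType) (bad : I -> Z -> bool) (nb : rel I) (cs : seq I).

Let none T z := all (fun i => ~~ bad i z) T.

Hypotheses (nb_refl : reflexive nb)
  (bad_indep : forall i T, all (fun j => ~~ nb i j) T ->
     Pr (fun z => bad i z && none T z) = Pr (bad i) * Pr (none T))
  (nb_small : forall i, i \in cs ->
     \sum_(j <- cs | nb i j) Pr (bad j) <= 4^-1).

Lemma ler_sum_subseq (J : eqType) (s t : seq J) (P : pred J) (f : J -> R) :
  (forall i, 0 <= f i) -> subseq s t ->
  \sum_(i <- s | P i) f i <= \sum_(i <- t | P i) f i.
Proof.
move=> f0; elim: t s => [|y t IH] [|x s] //=; first by rewrite big_nil sumr_ge0.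
case: eqP => [-> /IH le_st|_ /IH le_st].
  by rewrite !big_cons; case: ifP => _; rewrite ?lerD2l.
by apply: (le_trans le_st); rewrite [leRHS]big_cons; case: ifP => _; rewrite ?lerDr.
Qed.

Let Pr_mono (P Q : Z -> bool) : (forall z, P z -> Q z) -> Pr P <= Pr Q.
Proof.
move=> PQ; rewrite [leRHS](Pr_split _ P).
have -> : (fun z => Q z && P z) = P.
  by apply/funext => z; have := PQ z; case: (P z); rewrite ?andbT ?andbF // => ->.
by rewrite lerDl.
Qed.

Let Pr_false : Pr (fun=> false) = 0.
Proof. by have /= := Pr_split (fun=> false) (fun=> false); move: (Pr _) => p; lra. Qed.

Let union_bound T (Q : Z -> bool) :
  Pr Q <= Pr (fun z => none T z && Q z) +
    \sum_(i <- T) Pr (fun z => bad i z && Q z).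
Proof.
elim: T Q => [|i T IH] Q; first by rewrite big_nil addr0 /=.
have := IH (fun z => Q z && ~~ bad i z).
have -> : (fun z => none T z && (Q z && ~~ bad i z)) =
    (fun z => none (i :: T) z && Q z).
  by apply/funext => z /=; case: (bad i z); rewrite ?andbT ?andbF.
have : \sum_(j <- T) Pr (fun z => bad j z && (Q z && ~~ bad i z)) <=
    \sum_(j <- T) Pr (fun z => bad j z && Q z).
  by apply: ler_sum => j _; apply: Pr_mono => z; case: (bad j z); case: (Q z).
rewrite big_cons (Pr_split Q (bad i)).
have -> : (fun z => Q z && bad i z) = (fun z => bad i z && Q z).
  by apply/funext => z; rewrite andbC.
lra.
Qed.

Theorem local_lemma : exists z, none cs z.
Proof.
have bad_small i : i \in cs -> Pr (bad i) <= 4^-1.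
  move=> /[dup] ics /nb_small; apply: le_trans.
  by rewrite (big_rem i) //= nb_refl lerDl sumr_ge0.
(* Multiplied-out form of: given that nothing in [T] occurs, [bad i] has conditional probability at
   most [2 * Pr (bad i)]. This is at most 1/2, so each further event keeps at least half of
   [Pr (none T)]. *)
have key n T : (size T < n)%N -> subseq T cs -> 0 < Pr (none T) /\
    (forall i, i \in cs ->
      Pr (fun z => bad i z && none T z) <= 2 * Pr (bad i) * Pr (none T)).
  elim: n T => [//|n IH] T sT sub; have posT : 0 < Pr (none T).
    case: T sT sub => [//|j T] sT sub.
    have jcs : j \in cs by rewrite (mem_subseq sub) ?mem_head.
    have [pT /(_ j jcs) bT] := IH T sT (subseq_trans (subseq_cons T j) sub).
    rewrite (_ : none (j :: T) = fun z => none T z && ~~ bad j z); last first.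
      by apply/funext => z; rewrite /= andbC.
    have := Pr_split (none T) (bad j).
    rewrite (_ : (fun z => none T z && bad j z) = fun z => bad j z && none T z); last first.
      by apply/funext => z; rewrite andbC.
    have := ler_wpM2r (ltW pT) (bad_small j jcs); nra.
  split=> // i ics; pose T1 := [seq j <- T | nb i j]; pose T2 := [seq j <- T | ~~ nb i j].
  have le2 : 0 <= Pr (bad i) by [].
  have [nT1|T1n0] := boolP (all (fun j => ~~ nb i j) T).
    by rewrite bad_indep // ler_pM2r //; lra.
  have sT2 : (size T2 < n)%N.
    apply: leq_trans (ltnSE sT); rewrite size_filter ltn_neqAle count_size andbT.
    by rewrite -all_count.
  have sub2 : subseq T2 cs := subseq_trans (filter_subseq _ _) sub.
  have [pT2 bT2] := IH T2 sT2 sub2.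
  have T2i : all (fun j => ~~ nb i j) T2 by rewrite filter_all.
  (* The non-neighbours [T2] are independent of [bad i]. By the union bound over the neighbours [T1]
     and the induction hypothesis, passing from [none T2] to [none T] costs at most a factor 2. *)
  have up : Pr (fun z => bad i z && none T z) <= Pr (bad i) * Pr (none T2).
    rewrite -bad_indep //; apply: Pr_mono => z /andP[-> /allP nT] /=.
    by apply/allP => j; rewrite mem_filter => /andP[_]; exact: nT.
  have := union_bound T1 (none T2).
  have -> : (fun z => none T1 z && none T2 z) = none T.
    apply/funext => z; rewrite /none !all_filter -all_predI.
    by apply: eq_all => j /=; case: (nb i j); rewrite ?andbT.
  have : \sum_(j <- T1) Pr (fun z => bad j z && none T2 z) <=
      2^-1 * Pr (none T2).
    apply: (@le_trans _ _ (\sum_(j <- T1) 2 * Pr (none T2) * Pr (bad j))).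
      rewrite [leLHS]big_seq [leRHS]big_seq; apply: ler_sum => j jT1.
      rewrite mulrAC; apply: bT2.
      by move: jT1; rewrite mem_filter => /andP[_] /(mem_subseq sub).
    rewrite -mulr_sumr big_filter.
    have := le_trans (ler_sum_subseq (nb i) (fun j => Pr_ge0 (bad j)) sub) (nb_small ics).
    by move=> /(ler_wpM2l (ltW pT2)); nra.
  move=> s2 s1; have {}s1 : Pr (none T2) <= 2 * Pr (none T) by lra.
  by apply: le_trans up _; rewrite mulrAC mulrC ler_wpM2r // mulrC; nra.
have [] := key (size cs).+1 cs (ltnSn _) (subseq_refl _).
case: (pselect (exists z, none cs z)) => // nex + _.
suff -> : none cs = fun=> false by rewrite Pr_false ltxx.
by apply/funext => z; apply/negbTE/negP => nz; apply: nex; exists z.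
Qed.
End LocalLemma.

(** Compactness of the product: along an ultrafilter each coordinate, having finitely many values,
    settles on one, and finitely many coordinates settle together. *)
Lemma pointwise_limit (V : choiceType) (A : finType) (zs : nat -> V -> A) :
  exists z : V -> A, forall (D : seq V) n,
    exists2 m, (n <= m)%N & {in D, zs m =1 z}.
Proof.
have [U [ultraU UU]] := ultraFilterLemma eventually_filter.
have PU : ProperFilter U by exact: ultra_proper.
have ex v : exists a, U [set n | zs n v = a].
  apply: contrapT => /forallNP nex.
  have : U (fun n => forall a, a \in enum A -> zs n v <> a).
    elim: (enum A) => [|a r IH]; first exact: filterS filterT.
    have [//|Ua] := in_ultra_setVsetC [set n | zs n v = a] ultraU.
      by have := nex a.
    apply: filterS2 Ua IH => n na nr b.
    by rewrite inE => /orP[/eqP ->|/nr].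
  by move=> /filter_ex[n /(_ (zs n v))]; rewrite mem_enum => /(_ isT).
have [z zP] := choice ex; exists z => D n.
have UD : U (fun n => {in D, zs n =1 z}).
  elim: D => [|v D IH]; first exact: filterS filterT.
  apply: filterS2 (zP v) IH => m mv mD x.
  by rewrite inE => /orP[/eqP ->|/mD].
have [m [mn mD]] := filter_ex (filterI (UU _ (nbhs_infty_ge n)) UD).
by exists m.
Qed.

(** For [x >= 0], [expR x >= (x / 3) ^+ 3], and this cube beats the square once
    [n >= 27 * C / g ^+ 3]. *)
Lemma expR_ge_square (R : realType) (C g : R) : 0 < C -> 0 < g ->
  exists n0 : nat, forall n, (n0 <= n)%N -> C * n%:R ^+ 2 <= expR (g * n%:R).
Proof.
move=> C0 g0; pose B := 27 * C / g ^+ 3.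
exists (Num.truncn B).+1 => n nB.
have Bn : B <= n%:R.
  by apply: le_trans (ltW (truncnS_gt _)) _; rewrite ler_nat.
have n0 : 0 <= n%:R :> R by [].
have : (g * n%:R / 3) ^+ 3 <= expR (g * n%:R).
  rewrite [X in expR X](_ : _ = g * n%:R / 3 * 3%:R); last by field.
  rewrite expRM_natr.
  apply: lerXn2r; rewrite ?nnegrE ?expR_ge0 //.
    by rewrite mulr_ge0 ?mulr_ge0 // ltW.
  by have := expR_ge1Dx (g * n%:R / 3); lra.
apply: le_trans.
have -> : (g * n%:R / 3) ^+ 3 = (n%:R * (g ^+ 3 / 27)) * n%:R ^+ 2 by field.
rewrite ler_wpM2r ?exprn_ge0 //.
move: Bn; rewrite /B ler_pdivrMr ?exprn_gt0 //.
by rewrite mulrA ler_pdivlMr // mulrC.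
Qed.

Lemma infinite_uniq_seq (T : choiceType) (n : nat) : infinite_set [set: T] ->
  exists2 s : seq T, uniq s & size s = n.
Proof.
move=> /infinite_set_fset -/(_ n)[B _ nB].
exists (take n B); first by rewrite take_uniq.
by rewrite size_takel.
Qed.

(** * Derandomization *)

Section Derandomization.
Variables (R : realType) (G : groupType) (A : finType) (w : A -> R).
Hypotheses (countable_G : countable [set: G]) (infinite_G : infinite_set [set: G])
  (w_ge0 : forall a, 0 <= w a) (w_sum1 : \sum_a w a = 1).
Variables (J : finType) (f : J -> G -> (G -> A) -> R) (mean : J -> G -> R)
  (W : seq G).
Hypotheses
  (f_local : forall j g, local [seq (x * g)%g | x <- W] (f j g))
  (f_bound : forall j g z, `|f j g z| <= 1)
  (f_mean : forall j g vs z, uniq vs ->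
     {subset [seq (x * g)%g | x <- W] <= vs} -> Ex w vs (f j g) z <= mean j g).

Let window (S : seq G) (c : G) := [seq (x * (s * c))%g | x <- W, s <- S].

Let sum_local j S c :
  local (window S c) (fun z => \sum_(s <- S) f j (s * c)%g z).
Proof.
move=> z z' e; rewrite [LHS]big_seq [RHS]big_seq.
apply: eq_bigr => s sS; apply: f_local => v /mapP[x xW ->].
by apply: e; apply: allpairs_f.
Qed.

(** The summand at [s] reads [v] only if [s = x^-1 * v * c^-1] for some [x] in [W]; hence at most
    [size W] summands change, each by at most 2. *)
Let sum_osc j S c v z a a' : uniq S ->
  (\sum_(s <- S) f j (s * c)%g (upd z v a)) -
  (\sum_(s <- S) f j (s * c)%g (upd z v a')) <= 2 * (size W)%:R :> R.
Proof.
move=> uS; rewrite -sumrB.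
pose aff s := v \in [seq (x * (s * c))%g | x <- W].
apply: (@le_trans _ _ (\sum_(s <- S) 2 * (aff s)%:R)).
  apply: ler_sum => s _; rewrite /aff; case: (boolP (_ \in _)) => vs.
    have := f_bound j (s * c)%g (upd z v a).
    have := f_bound j (s * c)%g (upd z v a').
    by rewrite !ler_norml => /andP[? ?] /andP[? ?]; rewrite mulr1; lra.
  rewrite mulr0 (local_indep (@f_local _ _) vs).
  by rewrite (local_indep (@f_local _ _) vs) subrr.
rewrite -mulr_sumr ler_wpM2l // -natr_sum ler_nat.
rewrite -[leqLHS]big_mkcond sum1_count -size_filter /=.
rewrite -[leqRHS](size_map (fun x => (x^-1 * v * c^-1)%g)).
apply: uniq_leq_size; first exact: filter_uniq.
move=> s; rewrite mem_filter => /andP[/mapP[x xW ->] _].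
by apply/mapP; exists x => //; rewrite mulKg mulgK.
Qed.

(** The successor keeps [k] positive and leaves room for an extra 1 when neighbours are counted. *)
Let k := (size W).+1.

(** Chernoff's bound: Markov's inequality for the exponential, with [Ex_mgf] at oscillation [2 * k]
    and at most [k * size S] relevant coordinates. *)
Let tail j S c vs z (eta l : R) : uniq S -> uniq vs ->
  {subset window S c <= vs} -> 0 <= l -> l * (2 * k%:R) <= 2^-1 ->
  Ex w vs (fun z => (\sum_(s <- S) mean j (s * c)%g + eta * (size S)%:R <
                     \sum_(s <- S) f j (s * c)%g z)%R%:R) z <=
  expR (- l * eta * (size S)%:R +
        2 * (l * (2 * k%:R)) ^+ 2 * (k * size S)%:R).
Proof.
move=> uS uvs sub l0 lb; pose F z := \sum_(s <- S) f j (s * c)%g z.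
set M := \sum_(s <- S) mean _ _; set e := eta * _.
apply: (@le_trans _ _ (Ex w vs (fun z => expR (- l * (M + e)) * expR (l * F z)) z)).
  apply: Ex_le => // y; case: ltP => [lt|_]; last by rewrite mulr_ge0 ?expR_ge0.
  rewrite -expRD -[leLHS]expR0 ler_expR.
  have := ler_wpM2l l0 (ltW lt); rewrite -/(F y); lra.
rewrite ExZ.
have mgf := @Ex_mgf _ _ _ w w_ge0 w_sum1 vs (window S c) F l (2 * k%:R) uvs l0
  _ lb _ _ z.
apply: le_trans (ler_wpM2l (expR_ge0 _) (mgf _ _ _)) _ => [//||y v a a'|].
- by move=> v; apply: local_indep; exact: sum_local.
- apply: le_trans (sum_osc _ _ _ _ _ _ uS) _.
  by rewrite ler_pM2l // ler_nat.
rewrite -!expRD ler_expR.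
have : Ex w vs F z <= M.
  rewrite /F Ex_sum // /M [leLHS]big_seq [leRHS]big_seq.
  apply: ler_sum => s sS; apply: f_mean => // v /mapP[x xW ->].
  by apply: sub; apply: allpairs_f.
move=> /(ler_wpM2l l0).
have : (count (mem (window S c)) vs)%:R <= (k * size S)%:R :> R.
  rewrite ler_nat -size_filter; apply: (@leq_trans (size (window S c))).
    apply: uniq_leq_size; first exact: filter_uniq.
    by move=> v; rewrite mem_filter => /andP[].
  by rewrite size_allpairs leq_mul2r leqnSn orbT.
have : 0 <= 2 * (l * (2 * k%:R)) ^+ 2 :> R by rewrite mulr_ge0 ?sqr_ge0.
move: (2 * _ ^+ 2) => q q0 /(ler_wpM2l q0); rewrite /e.
by rewrite mulrDr !mulNr mulrA; lra.
Qed.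

Let big_event S (e : R) c z := [exists j,
  \sum_(s <- S) mean j (s * c)%g + e * (size S)%:R <
  \sum_(s <- S) f j (s * c)%g z].

Let event_local S e c : local (window S c) (big_event S e c).
Proof. by move=> z z' ez; apply: eq_existsb => j; rewrite (@sum_local j S c _ _ ez). Qed.

Let finite_derandomize (e : R) : 0 < e -> e <= 1 ->
  exists2 S, (0 < size S)%N & forall cs, uniq cs ->
    exists z, all (fun c => ~~ big_event S e c z) cs.
Proof.
move=> e0 e1; have k0 : 0 < k%:R :> R by [].
have k1 : 1 <= k%:R :> R by rewrite ler1n.
(* [C * n ^ 2] absorbs the [#|J|] alternatives in one event and its at most [(k * n) ^ 2]
   neighbours, with the factor 4 that the local lemma asks for. *)
pose C : R := 8 * (#|J|.+1)%:R * k%:R ^+ 2.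
have C0 : 0 < C by rewrite !mulr_gt0 // ?exprn_gt0.
(* [l] minimizes the exponent [- l * e * n + 8 * l ^ 2 * k ^ 3 * n] of [tail]; the minimum is
   [- g * n]. *)
pose l := e / (16 * k%:R ^+ 3); pose g := e ^+ 2 / (32 * k%:R ^+ 3).
have k30 : 0 < k%:R ^+ 3 :> R by rewrite exprn_gt0.
have g0 : 0 < g by rewrite divr_gt0 ?exprn_gt0 // mulr_gt0.
have l0 : 0 <= l by rewrite divr_ge0 ?ltW // mulr_gt0.
have lk : l * (2 * k%:R) <= 2^-1.
  rewrite /l mulrAC ler_pdivrMr ?mulr_gt0 //.
  have : k%:R <= k%:R ^+ 3 :> R by rewrite ler_eXnr.
  have := ler_wpM2r (ltW k0) e1; lra.
have [n0 n0P] := expR_ge_square C0 g0.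
(* Only the number of points of [S] matters, not its shape: concentration comes from the
   independence of the coordinates. *)
have [S uS sS] := infinite_uniq_seq (maxn n0 1) infinite_G.
pose n := size S; have {}n0P : C * n%:R ^+ 2 <= expR (g * n%:R).
  by apply: n0P; rewrite /n sS leq_maxl.
have nS : (0 < n)%N by rewrite /n sS leq_maxr.
exists S => // cs ucs.
have [a0 _] : exists a0 : A, True.
  apply: contrapT => nA; have := w_sum1; rewrite big1 => [/eqP|a].
    by rewrite eq_sym oner_eq0.
  by case: nA; exists a.
pose vs := undup (flatten [seq window S c | c <- cs]).
pose Pr (P : (G -> A) -> bool) := Ex w vs (fun z => (P z)%:R) (fun=> a0).
have small c : c \in cs -> Pr (big_event S e c) <= #|J|%:R * expR (- (g * n%:R)).
  move=> ccs; apply: (@le_trans _ _ (\sum_j Ex w vs (fun z =>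
      (\sum_(s <- S) mean j (s * c)%g + e * (size S)%:R <
       \sum_(s <- S) f j (s * c)%g z)%R%:R) (fun=> a0))).
    rewrite -Ex_sum //; apply: Ex_le => // z; rewrite /big_event.
    case: existsP => [[j lt]|_]; last by rewrite sumr_ge0.
    by rewrite (bigD1 j) //= lt lerDl sumr_ge0.
  rewrite -sum1_card natr_sum mulr_suml; apply: ler_sum => j _.
  rewrite mul1r; apply: le_trans (tail _ _ _ uS (undup_uniq _) _ l0 lk) _.
    move=> v vc; rewrite mem_undup; apply/flattenP.
    by exists (window S c) => //; apply: map_f.
  rewrite ler_expR -/n natrM /l /g le_eqVlt; apply/orP; left; apply/eqP.
  by field; rewrite gt_eqF.
pose nb c c' := (c == c') || has (mem (window S c)) (window S c').
apply: (@local_lemma R _ Pr _ _ _ _ (big_event S e) nb).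
- by move=> P; apply: Ex_ge0.
- by rewrite /Pr Ex_const.
- move=> P Q; rewrite -ExD; apply: eq_Ex => z.
  by case: (P z); case: (Q z); rewrite ?addr0 ?add0r.
- by move=> c; rewrite /nb eqxx.
- move=> c T nT; rewrite /Pr -Ex_mul //.
    by apply: eq_Ex => z; rewrite -natrM mulnb.
  move=> v _; have [vc|vc] := boolP (v \in window S c); [right|left] => z b.
    congr (_%:R); congr nat_of_bool; apply: eq_in_all => c' /(allP nT).
    rewrite /nb negb_or => /andP[_ /hasPn nc'].
    rewrite (local_indep (@event_local S e c')) //.
    by apply: contraTN vc => /nc'.
  by rewrite (local_indep (@event_local S e c)).
- move=> c ccs; apply: (@le_trans _ _ (\sum_(c' <- cs | nb c c')
      #|J|%:R * expR (- (g * n%:R)))).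
    rewrite [leLHS]big_seq_cond [leRHS]big_seq_cond.
    by apply: ler_sum => c' /andP[c'cs _]; exact: small.
  rewrite -big_filter big_const_seq count_predT iter_addr_0 -[leLHS]mulr_natr.
  (* A neighbour [c'] of [c] satisfies [q * c' = p * c] with [p] and [q] among the [size W * n]
     products of [W] and [S], or equals [c]. *)
  have szw : (size [seq c' <- cs | nb c c'] <= (k * n) ^ 2)%N.
    pose P := [seq (x * s)%g | x <- W, s <- S].
    have sP : size P = (size W * n)%N by rewrite size_allpairs.
    apply: (@leq_trans (size (c :: [seq (q^-1 * (p * c))%g | p <- P, q <- P]))).
      apply: uniq_leq_size; first exact: filter_uniq.
      move=> c'; rewrite mem_filter => /andP[+ _]; rewrite inE eq_sym.
      case/orP => [->//|/hasP[v /allpairsP[[x s] /= [xW sS' ->]]]].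
      move=> /allpairsP[[x' s'] /= [x'W s'S e']]; apply/orP; right.
      apply/allpairsP; exists ((x' * s')%g, (x * s)%g); split=> /=.
      - exact: allpairs_f.
      - exact: allpairs_f.
      - by rewrite -[(x' * s' * c)%g]mulgA -e' [(x * (_ * _))%g]mulgA mulKg.
    rewrite /= size_allpairs sP /k mulSn [(n + _)%N]addnC sqrnD -addnA -mulnn.
    by rewrite -addn1 leq_add2l addn_gt0 sqrn_gt0 nS.
  apply: (@le_trans _ _ (#|J|%:R * expR (- (g * n%:R)) * ((k * n) ^ 2)%:R)).
    by rewrite ler_wpM2l ?ler_nat // mulr_ge0 ?expR_ge0.
  rewrite expRN mulrAC ler_pdivrMr ?expR_gt0 //.
  apply: le_trans (_ : 4^-1 * (C * n%:R ^+ 2) <= _); last by rewrite ler_wpM2l.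
  rewrite /C natrX natrM exprMn.
  have : #|J|%:R <= #|J|.+1%:R :> R by rewrite ler_nat.
  have : 0 <= k%:R ^+ 2 * n%:R ^+ 2 :> R by rewrite mulr_ge0 ?sqr_ge0.
  move: (k%:R ^+ 2) (n%:R ^+ 2) => x y xy /(ler_wpM2r xy).
  have := mulr_ge0 (ler0n R #|J|.+1) xy; lra.
Qed.

(** Each event sees finitely many coordinates, so a pointwise limit of solutions for growing finite
    families of centers avoids the events at all centers. *)
Theorem derandomize (eta : R) : 0 < eta -> exists S z, [/\ (0 < size S)%N &
  forall j c, \sum_(s <- S) f j (s * c)%g z <=
    \sum_(s <- S) mean j (s * c)%g + eta * (size S)%:R].
Proof.
move=> eta0; have [||S S0 SP] := @finite_derandomize (Num.min eta 1).
- by rewrite lt_min eta0 /=.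
- by rewrite ge_min lexx orbT.
have /countable_injP[e einj] := countable_G.
pose pts n := undup [seq xget 1%g [set g | e g = i] | i <- iota 0 n].
have [zs zsP] := choice (fun n => SP (pts n) (undup_uniq _)).
have [z zP] := pointwise_limit zs.
exists S, z; split=> // j c.
have [m em mz] := zP (window S c) (e c).+1.
have cm : c \in pts m.
  rewrite mem_undup; apply/mapP; exists (e c); first by rewrite mem_iota.
  case: xgetP => [g _ /= eg|/(_ c) []//].
  by apply: (einj c g); rewrite ?in_setT.
have := allP (zsP m) c cm; rewrite (@event_local S _ c _ _ mz) negb_exists => /forallP/(_ j).
rewrite -leNgt => /le_trans; apply; rewrite lerD2l ler_wpM2r //.
by rewrite ge_min lexx.
Qed.
End Derandomization.

(** * Uniform averages along a Folner sequence *)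

Section UniformUpperBound.
Variables (R : realType) (G : groupType) (F : nat -> {fset G}).
Hypothesis folner_F : folner_sequence R F.
Implicit Types (f g : G -> R) (m : R).

Lemma folner_shift_sum f (M : R) s N : (forall x, `|f x| <= M) ->
  `|\sum_(x <- F N) f (s * x)%g - \sum_(x <- F N) f x| <=
  M * #|` fset_symdiff (fset_ltranslate s (F N)) (F N)|%:R.
Proof.
move=> fM; set A := fset_ltranslate s (F N).
have -> : \sum_(x <- F N) f (s * x)%g = \sum_(x <- A) f x.
  rewrite -(big_map (fun x => (s * x)%g) xpredT f); apply: perm_big.
  apply: uniq_perm; rewrite ?fset_uniq //.
    by rewrite map_inj_uniq ?fset_uniq //; exact: mulgI.
  move=> y; apply/mapP/imfsetP => -[x /= xF ->]; by exists x.
have part (B C : {fset G}) : `|\sum_(x <- B | x \notin C) f x| <=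
    M * #|` (B `\` C)%fset|%:R.
  apply: le_trans (ler_norm_sum _ _ _) _.
  rewrite -big_filter; apply: le_trans (ler_sum _ (fun x _ => fM x)) _.
  rewrite big_const_seq count_predT iter_addr_0 -[leLHS]mulr_natr.
  rewrite ler_wpM2l //; first exact: le_trans (normr_ge0 _) (fM 1%g).
  rewrite ler_nat; apply: uniq_leq_size; first by rewrite filter_uniq ?fset_uniq.
  by move=> x; rewrite mem_filter inE.
have -> : \sum_(x <- A) f x - \sum_(x <- F N) f x =
    \sum_(x <- A | x \notin F N) f x - \sum_(x <- F N | x \notin A) f x.
  rewrite (bigID (mem (F N))) /= [X in _ - X](bigID (mem A)) /=.
  suff -> : \sum_(x <- A | x \in F N) f x = \sum_(x <- F N | x \in A) f x by ring.
  rewrite -[LHS]big_filter -[RHS]big_filter; apply: perm_big.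
  apply: uniq_perm; rewrite ?filter_uniq ?fset_uniq // => x.
  by rewrite !mem_filter andbC.
apply: le_trans (ler_normB _ _) _.
apply: le_trans (lerD (part _ _) (part _ _)) _.
rewrite -mulrDr -natrD ler_wpM2l ?ler_nat //.
  exact: le_trans (normr_ge0 _) (fM 1%g).
rewrite /fset_symdiff cardfsU.
suff -> : ((A `\` F N) `&` (F N `\` A) = fset0)%fset by rewrite cardfs0 subn0.
apply/fsetP => x; rewrite !inE; by case: (x \in A); case: (x \in F N).
Qed.

Lemma folner_card_gt0 N : 0 < #|` F N|%:R :> R.
Proof. by rewrite ltr0n lt0n cardfs_eq0; case: folner_F. Qed.

Lemma folner_near (S : seq G) (e : R) : 0 < e -> \forall N \near \oo,
  {in S, forall s,
    #|` fset_symdiff (fset_ltranslate s (F N)) (F N)|%:R <= e * #|` F N|%:R}.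
Proof.
move=> e0; elim: S => [|s S IH]; first by near=> N.
have [_ /(_ s) /cvgr0Pnorm_le /(_ _ e0) lim_s] := folner_F.
near=> N; move=> x; rewrite inE => /orP[/eqP -> {x}|xS]; last first.
  by move: x xS; near: N.
have : `|#|` fset_symdiff (fset_ltranslate s (F N)) (F N)|%:R /
   #|` F N|%:R| <= e by near: N.
by rewrite ger0_norm ?divr_ge0 // ler_pdivrMr ?folner_card_gt0.
Unshelve. all: by end_near. Qed.

(* Uniformity over the right translates [F N * c] is what makes these bounds
   additive and usable at a common scale [N]. *)
Definition uniform_ub f m := forall eta : R, 0 < eta ->
  \forall N \near \oo, forall c,
    \sum_(x <- F N) f (x * c)%g <= (m + eta) * #|` F N|%:R.

Lemma sum_const_fset (N : nat) (m : R) : \sum_(x <- F N) m = m * #|` F N|%:R.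
Proof. by rewrite big_const_seq count_predT iter_addr_0 mulr_natr. Qed.

Lemma ub_const m : uniform_ub (fun=> m) m.
Proof.
move=> eta eta0; near=> N; move=> c.
by rewrite sum_const_fset ler_wpM2r // lerDl ltW.
Unshelve. all: by end_near. Qed.

Lemma ub_le f g m m' : (forall x, f x <= g x) -> m <= m' ->
  uniform_ub g m -> uniform_ub f m'.
Proof.
move=> fg mm' ub eta /ub {}ub; near=> N; move=> c.
apply: (@le_trans _ _ (\sum_(x <- F N) g (x * c)%g)); first exact: ler_sum.
apply: (@le_trans _ _ ((m + eta) * #|` F N|%:R)); last first.
  by rewrite ler_wpM2r // lerD2r.
by move: c; near: N.
Unshelve. all: by end_near. Qed.

Lemma ubD f g m m' : uniform_ub f m -> uniform_ub g m' ->
  uniform_ub (fun x => f x + g x) (m + m').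
Proof.
move=> uf ug eta eta0; have e2 : 0 < eta / 2 by rewrite divr_gt0.
have {}uf := uf _ e2; have {}ug := ug _ e2; near=> N; move=> c.
rewrite big_split /= (_ : m + m' + eta = m + eta / 2 + (m' + eta / 2)); last by field.
rewrite mulrDl lerD //; move: c; by near: N.
Unshelve. all: by end_near. Qed.

Lemma ubZ k f m : 0 <= k -> uniform_ub f m -> uniform_ub (fun x => k * f x) (k * m).
Proof.
move=> k0 uf eta eta0; have e2 : 0 < eta / (k + 1) by rewrite divr_gt0 // ltr_wpDl.
have {}uf := uf _ e2; near=> N; move=> c; rewrite -mulr_sumr.
have : \sum_(x <- F N) f (x * c)%g <= (m + eta / (k + 1)) * #|` F N|%:R.
  by move: c; near: N.
move=> /(ler_wpM2l k0) /le_trans; apply.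
rewrite mulrA ler_wpM2r // mulrDr lerD2l mulrCA ger_pMr //.
by rewrite ler_pdivrMr ?mul1r ?lerDl // ltr_wpDl.
Unshelve. all: by end_near. Qed.

(** Double counting: left invariance of [F N] allows each sum over [F N] to be replaced by its
    shifts by [s] in [S]; after exchanging the sums, the inner one runs over the right translate of
    [S] at [x * c]. *)
Lemma ub_scale (S : seq G) f m M : (0 < size S)%N -> (forall x, `|f x| <= M) ->
  (forall c, \sum_(s <- S) f (s * c)%g <= m * (size S)%:R) -> uniform_ub f m.
Proof.
move=> S0 fM fS eta eta0; have M0 : 0 <= M := le_trans (normr_ge0 _) (fM 1%g).
have n0 : 0 < (size S)%:R :> R by rewrite ltr0n.
have e0 : 0 < eta / (M + 1) by rewrite divr_gt0 // ltr_wpDl.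
have near_S := folner_near S e0.
near=> N; move=> c; rewrite -(ler_pM2l n0).
apply: (@le_trans _ _ (\sum_(s <- S) (\sum_(x <- F N) f (s * (x * c))%g +
    eta * #|` F N|%:R))).
  rewrite [leLHS](_ : _ = \sum_(s <- S) \sum_(x <- F N) f (x * c)%g); last first.
    by rewrite big_const_seq count_predT iter_addr_0 mulr_natl.
  rewrite [leLHS]big_seq [leRHS]big_seq; apply: ler_sum => s sS.
  rewrite -lerBlDl.
  have := @folner_shift_sum (fun x => f (x * c)%g) M s N (fun x => fM _).
  under eq_bigr do rewrite -mulgA.
  rewrite distrC ler_norml => /andP[_].
  move=> /le_trans; apply.
  have : #|` fset_symdiff (fset_ltranslate s (F N)) (F N)|%:R <=
      eta / (M + 1) * #|` F N|%:R by move: s sS; near: N.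
  move=> /(ler_wpM2l M0) /le_trans; apply.
  rewrite mulrA ler_wpM2r // mulrCA ger_pMr //.
  by rewrite ler_pdivrMr ?mul1r ?lerDl // ltr_wpDl.
rewrite big_split /= big_const_seq count_predT iter_addr_0 exchange_big /=.
apply: (@le_trans _ _ (\sum_(x <- F N) m * (size S)%:R + eta * #|` F N|%:R *+ size S)).
  by rewrite lerD2r; apply: ler_sum.
rewrite sum_const_fset -[_ *+ size S]mulr_natr le_eqVlt; apply/orP; left; apply/eqP.
ring.
Unshelve. all: by end_near. Qed.

Lemma ub_shift h f m M : (forall x, `|f x| <= M) -> uniform_ub f m ->
  uniform_ub (fun x => f (h * x)%g) m.
Proof.
move=> fM uf eta eta0; have M0 : 0 <= M := le_trans (normr_ge0 _) (fM 1%g).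
have e2 : 0 < eta / 2 by rewrite divr_gt0.
have e0 : 0 < eta / 2 / (M + 1) by rewrite divr_gt0 // ltr_wpDl.
have near_h := folner_near [:: h] e0; have {}uf := uf _ e2.
near=> N; move=> c.
have := @folner_shift_sum (fun x => f (x * c)%g) M h N (fun x => fM _).
under eq_bigr do rewrite -mulgA.
rewrite ler_norml => /andP[_].
have : #|` fset_symdiff (fset_ltranslate h (F N)) (F N)|%:R <=
    eta / 2 / (M + 1) * #|` F N|%:R.
  by apply: (near near_h N) => //; rewrite inE.
move=> /(ler_wpM2l M0).
have : M * (eta / 2 / (M + 1) * #|` F N|%:R) <= eta / 2 * #|` F N|%:R.
  rewrite mulrA ler_wpM2r // mulrCA ger_pMr //.
  by rewrite ler_pdivrMr ?mul1r ?lerDl // ltr_wpDl.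
have : \sum_(x <- F N) f (x * c)%g <= (m + eta / 2) * #|` F N|%:R.
  by move: c; near: N.
rewrite !mulrDl; lra.
Unshelve. all: by end_near. Qed.

End UniformUpperBound.

(** * Sieves *)

Section Sieves.
Variables (R : realType) (G : groupType) (F : nat -> {fset G}).
Hypotheses (countable_G : countable [set: G]) (infinite_G : infinite_set [set: G])
  (folner_F : folner_sequence R F).

Lemma derandomize_ub (A : finType) (w : A -> R) (J : finType)
    (f : J -> G -> (G -> A) -> R) (mean : J -> G -> R) (W : seq G) (eta : R) :
  (forall a, 0 <= w a) -> \sum_a w a = 1 ->
  (forall j g, local [seq (x * g)%g | x <- W] (f j g)) ->
  (forall j g z, `|f j g z| <= 1) -> (forall j g, `|mean j g| <= 1) ->
  (forall j g vs z, uniq vs ->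
     {subset [seq (x * g)%g | x <- W] <= vs} -> Ex w vs (f j g) z <= mean j g) ->
  0 < eta ->
  exists z, forall j, uniform_ub F (fun g => f j g z - mean j g) eta.
Proof.
move=> w0 w1 lf bf bm mf eta0.
have [S [z [S0 Sz]]] :=
  derandomize countable_G infinite_G w0 w1 lf bf mf eta0.
exists z => j; apply: (@ub_scale _ _ _ folner_F S _ _ 2) => // [x|c].
  by rewrite (le_trans (ler_normB _ _)) // -natr1 lerD.
by rewrite sumrB lerBlDl.
Qed.

Variables (I : finType) (hs : I -> G).

(* [C] behaves like an independent random set of density [p] and pair correlations
   [r], uniformly and against every finite family of weights. *)
Definition sieve (p : R) (r : I -> G -> R) :=
  forall (J : finType) (u : J -> G -> R) (eta : R), 0 < eta ->
  (forall j g, 0 <= u j g <= 1) ->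
  exists C : G -> bool, forall j,
  [/\ uniform_ub F (fun g => (C g)%:R * u j g - p * u j g) eta,
      uniform_ub F (fun g => p * u j g - (C g)%:R * u j g) eta &
      forall i, uniform_ub F (fun g => (C g)%:R * (C ((hs i)^-1 * g)%g)%:R * u j g -
                                       r i g * u j g) eta].

Lemma local_sieve (A : finType) (w : A -> R) (W : seq G)
    (D : G -> (G -> A) -> bool) (p : R) (r : I -> G -> R) :
  (forall a, 0 <= w a) -> \sum_a w a = 1 ->
  (forall g, local [seq (x * g)%g | x <- W] (D g)) ->
  0 <= p <= 1 -> (forall i g, 0 <= r i g <= 1) ->
  (forall g vs z, {subset [seq (x * g)%g | x <- W] <= vs} ->
    Ex w vs (fun z => (D g z)%:R) z = p) ->
  (forall i g vs z, {subset [seq (x * g)%g | x <- W] <= vs} ->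
    {subset [seq (x * ((hs i)^-1 * g))%g | x <- W] <= vs} ->
    Ex w vs (fun z => (D g z)%:R * (D ((hs i)^-1 * g)%g z)%:R) z <= r i g) ->
  sieve p r.
Proof.
move=> w0 w1 lD /andP[p0 p1] r01 mp mr J u eta eta0 u01.
(* A correlation reads the window both at [g] and at [(hs i)^-1 * g]. All clauses of [sieve] are
   then derandomized at once, the density with both signs. *)
pose W' := W ++ [seq (x * (hs i)^-1)%g | x <- W, i <- enum I].
pose f (t : J + J + J * I) g z : R := match t with
  | inl (inl j) => u j g * (D g z)%:R
  | inl (inr j) => - (u j g * (D g z)%:R)
  | inr (j, i) => u j g * ((D g z)%:R * (D ((hs i)^-1 * g)%g z)%:R)
  end.
pose m (t : J + J + J * I) g : R := match t with
  | inl (inl j) => u j g * p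
  | inl (inr j) => - (u j g * p)
  | inr (j, i) => u j g * r i g
  end.
have subW g : {subset [seq (x * g)%g | x <- W] <= [seq (x * g)%g | x <- W']}.
  by move=> v /mapP[x xW ->]; apply: map_f; rewrite mem_cat xW.
have subWh i g : {subset [seq (x * ((hs i)^-1 * g))%g | x <- W] <=
                         [seq (x * g)%g | x <- W']}.
  move=> v /mapP[x xW ->]; rewrite mulgA; apply: map_f.
  by rewrite mem_cat; apply/orP; right; apply: allpairs_f; rewrite ?mem_enum.
have [] := @derandomize_ub A w _ f m W' eta w0 w1 _ _ _ _ eta0.
- move=> t g z z' e; have eD : D g z = D g z' by apply: lD => v /subW/e.
  have eDh i : D ((hs i)^-1 * g)%g z = D ((hs i)^-1 * g)%g z'.
    by apply: lD => v /subWh/e.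
  by case: t => [[]j|[j i]] /=; rewrite ?eD ?eDh.
- have b01 (b c : bool) j g : `|u j g * (b%:R * c%:R)| <= 1.
    have /andP[u0 u1] := u01 j g.
    by case: b; case: c; rewrite ?(mul0r, mulr0, mulr1, normr0) // ger0_norm.
  case=> [[]j|[j i]] g z /=; rewrite ?normrN //.
    by have := b01 (D g z) true j g; rewrite mulr1.
  by have := b01 (D g z) true j g; rewrite mulr1.
- have b01 x j g : 0 <= x <= 1 -> `|u j g * x| <= 1.
    move=> /andP[x0 x1]; have /andP[u0 u1] := u01 j g.
    by rewrite ger0_norm ?mulr_ge0 // mulr_ile1.
  by case=> [[]j|[j i]] g /=; rewrite ?normrN b01 // p0.
- case=> [[]j|[j i]] g vs z _ sub /=.
  + by rewrite ExZ mp // => v /subW/sub.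
  + by rewrite ExN // ExZ mp // => v /subW/sub.
  + rewrite ExZ ler_wpM2l //; first by case/andP: (u01 j g).
    by apply: mr => v; [move=> /subW/sub|move=> /subWh/sub].
move=> z zP; exists (fun g => D g z) => j; split=> [||i].
- apply: ub_le (zP (inl (inl j))) => // g /=; lra.
- apply: ub_le (zP (inl (inr j))) => // g /=; lra.
- apply: ub_le (zP (inr (j, i))) => // g /=; lra.
Qed.

Lemma sieve_trivial : sieve 1 (fun _ _ => 1).
Proof.
move=> J u eta eta0 _; exists (fun=> true) => j.
have ub0 : uniform_ub F (fun=> 0) eta by apply: ub_le (ub_const F 0) => //; exact: ltW.
by split=> [||i]; apply: ub_le ub0 => // g; rewrite !mul1r subrr.
Qed.

(** This is what the weights in [sieve] are for: [C2] is chosen after [C1], against weights that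
    contain [C1], while [C1] is tested against [u] and [r2 * u]. *)
Lemma sieve_mul (p1 p2 : R) (r1 r2 : I -> G -> R) : 0 <= p2 <= 1 -> (forall i g, 0 <= r2 i g <= 1) ->
  sieve p1 r1 -> sieve p2 r2 -> sieve (p1 * p2) (fun i g => r1 i g * r2 i g).
Proof.
move=> /andP[p0 p1'] r01 s1 s2 J u eta eta0 u01.
have e2 : 0 < eta / 2 by rewrite divr_gt0.
pose u1 (t : J + J * I) g : R := match t with
  | inl j => u j g | inr (j, i) => r2 i g * u j g end.
have [|C1 C1P] := s1 _ u1 _ e2.
  case=> [j|[j i]] g //=; have /andP[? ?] := u01 j g; have /andP[? ?] := r01 i g.
  by rewrite mulr_ge0 // mulr_ile1.
pose u2 (t : J + J * I) g : R := match t with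
  | inl j => (C1 g)%:R * u j g
  | inr (j, i) => (C1 g)%:R * (C1 ((hs i)^-1 * g)%g)%:R * u j g end.
have [|C2 C2P] := s2 _ u2 _ e2.
  case=> [j|[j i]] g //=; have /andP[? ?] := u01 j g.
    by rewrite mulr_ge0 // mulr_ile1 //; case: (C1 g).
  by rewrite mulr_ge0 ?mulr_ge0 // mulr_ile1 //; case: (C1 g); case: (C1 _); rewrite ?mulr0 ?mulr1.
exists (fun g => C1 g && C2 g) => j.
have [a1 b1 _] := C1P (inl j); have [a2 b2 _] := C2P (inl j).
have ee : eta / 2 + p2 * (eta / 2) <= eta by have := ler_wpM2r (ltW e2) p1'; lra.
split=> [||i].
- apply: ub_le (ubD a2 (ubZ p0 a1)) => // g /=.
  rewrite -mulnb natrM; lra.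
- apply: ub_le (ubD b2 (ubZ p0 b1)) => // g /=.
  rewrite -mulnb natrM; lra.
have [_ _ /(_ i) c1] := C1P (inr (j, i)); have [_ _ /(_ i) c2] := C2P (inr (j, i)).
apply: ub_le (ubD c2 c1) => [g /=|]; last by lra.
by rewrite -!mulnb !natrM; lra.
Qed.

End Sieves.

(** * Thinning by bits and maps to common centers *)

Section ConcreteSieves.
Variables (R : realType) (G : groupType) (F : nat -> {fset G}).
Hypotheses (countable_G : countable [set: G]) (infinite_G : infinite_set [set: G])
  (folner_F : folner_sequence R F).
Variables (I : finType) (hs : I -> G).
Hypothesis hs_neq1 : forall i, hs i != 1%g.

Lemma Ex_prod (V : choiceType) (A : finType) (w : A -> R)
    (w_sum1 : \sum_a w a = 1)
    (vs us : seq V) (k : V -> A -> R) z :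
  uniq us -> {subset us <= vs} ->
  Ex w vs (fun z => \prod_(u <- us) k u (z u)) z =
  \prod_(u <- us) \sum_a w a * k u a.
Proof.
elim: us => [_ _|u us IH /= /andP[uus uus' sub]].
  rewrite big_nil -[RHS](Ex_const w_sum1 vs 1 z).
  by apply: eq_Ex => y; rewrite big_nil.
rewrite big_cons -IH //; last by move=> v vus; apply: sub; rewrite inE vus orbT.
rewrite -(@Ex_coordM _ _ _ w w_sum1 vs u (k u)) //; [|by apply: sub; rewrite mem_head|].
  by apply: eq_Ex => y; rewrite big_cons.
move=> y a; rewrite big_seq [RHS]big_seq; apply: eq_bigr => v vus.
by rewrite upd_other //; apply: contraNneq uus => <-.
Qed.

(* The set of [g] with bit 1 at [g] and bit 0 at [s^-1 g] misses its translate by [s]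
   and has pairwise independent, or disjoint, other translates. *)
Lemma sieve_shift (s : G) : s != 1%g ->
  sieve F hs (4^-1 : R) (fun i _ => (hs i != s)%:R / 16).
Proof.
move=> s1; pose w (b : bool) : R := 2^-1.
have w1 : \sum_b w b = 1 by rewrite big_bool /w /=; lra.
have w0 b : 0 <= w b by rewrite /w.
have wid : \sum_b w b * b%:R = 2^-1 by rewrite big_bool /w /= mulr1 mulr0 ?addr0 ?add0r.
have wneg : \sum_b w b * (~~ b)%:R = 2^-1 by rewrite big_bool /w /= mulr1 mulr0 ?addr0 ?add0r.
have shift_neq g : (s^-1 * g)%g != g.
  by rewrite -[X in _ != X]mul1g (inj_eq (@mulIg _ g)) eqg_invLR invg1.
pose D (g : G) (z : G -> bool) := z g && ~~ z (s^-1 * g)%g.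
have gW g : g \in [seq (x * g)%g | x <- [:: 1%g; s^-1%g]].
  by rewrite /= !inE mul1g eqxx.
have sgW g : (s^-1 * g)%g \in [seq (x * g)%g | x <- [:: 1%g; s^-1%g]].
  by rewrite /= !inE eqxx orbT.
have indU (v u : G) (k : bool -> R) (H : (G -> bool) -> R) : u != v -> indep v H ->
    indep v (fun z => k (z u) * H z).
  by move=> uv iH z a; rewrite iH upd_other.
have ind1 (v u : G) (k : bool -> R) : u != v -> indep v (fun z : G -> bool => k (z u)).
  by move=> uv z a; rewrite upd_other.
apply: (@local_sieve _ _ _ countable_G infinite_G folner_F _ _ _ w
  [:: 1%g; s^-1%g] D) => //.
- by move=> g z z' e; rewrite /D !e.
- by apply/andP; split; lra.
- by move=> i g; case: (hs i != s); rewrite ?mul1r ?mul0r; apply/andP; split; lra.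
- move=> g vs z sub.
  rewrite [LHS](_ : _ = Ex w vs (fun z => (z g)%:R * (~~ z (s^-1 * g)%g)%:R) z);
    last by apply: eq_Ex => y; rewrite -natrM mulnb.
  rewrite (Ex_coordM w1 (fun b : bool => b%:R)) ?sub //; last first.
    exact: (ind1 _ _ (fun b : bool => (~~ b)%:R)).
  by rewrite (Ex_coord w1 (fun b : bool => (~~ b)%:R)) ?sub // wid wneg /=; field.
move=> i g vs z sub subh; set g' := ((hs i)^-1 * g)%g.
have gg' : g' != g.
  by rewrite -[X in _ != X]mul1g (inj_eq (@mulIg _ g)) eqg_invLR invg1.
(* If [hs i = s], the site [s^-1 * g] would carry both bits; if [hs i = s^-1], the site [g] would.
   Otherwise the four sites are distinct and their fair bits independent. *)
have [his|his] := eqVneq (hs i) s.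
  rewrite mul0r -[leRHS](Ex_const w1 vs 0 z); apply: Ex_le => // y.
  by rewrite /D /g' his; case: (y (s^-1 * g)%g); rewrite ?andbF ?(mul0r, mulr0).
have [gs|gs] := eqVneq (s^-1 * g')%g g.
  apply: (@le_trans _ _ 0); last by rewrite divr_ge0.
  rewrite -[leRHS](Ex_const w1 vs 0 z); apply: Ex_le => // y.
  by rewrite /D gs; case: (y g); rewrite ?andbF ?(mul0r, mulr0).
have sgg' : (s^-1 * g)%g != g'.
  by rewrite /g' (inj_eq (@mulIg _ g)) (inj_eq invg_inj) eq_sym.
have sgsg' : (s^-1 * g)%g != (s^-1 * g')%g.
  by rewrite (inj_eq (@mulgI _ _)) eq_sym.
rewrite [leLHS](_ : _ = Ex w vs (fun z => (z g)%:R * ((~~ z (s^-1 * g)%g)%:R *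
    ((z g')%:R * (~~ z (s^-1 * g')%g)%:R))) z); last first.
  by apply: eq_Ex => y; rewrite -!natrM !mulnb /D !andbA.
rewrite (Ex_coordM w1 (fun b : bool => b%:R)) ?sub //; last first.
  apply: (indU _ _ (fun b : bool => (~~ b)%:R)) => //.
  apply: (indU _ _ (fun b : bool => b%:R)) => //.
  exact: (ind1 _ _ (fun b : bool => (~~ b)%:R)).
rewrite (Ex_coordM w1 (fun b : bool => (~~ b)%:R)) ?sub //; last first.
  apply: (indU _ _ (fun b : bool => b%:R)); first by rewrite eq_sym.
  by apply: (ind1 _ _ (fun b : bool => (~~ b)%:R)); rewrite eq_sym.
rewrite (Ex_coordM w1 (fun b : bool => b%:R)) ?subh //; last first.
  exact: (ind1 _ _ (fun b : bool => (~~ b)%:R)).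
rewrite (Ex_coord w1 (fun b : bool => (~~ b)%:R)) ?subh // wid wneg /=; lra.
Qed.


(** The product is the chance that [x] is the only active point of [U]; Bernoulli's inequality
    handles the inactive ones. *)
Lemma prod_one_active (T : choiceType) (U : seq T) (x : T) (q : R) :
  uniq U -> x \in U -> 0 <= q <= 1 ->
  q * (1 - (size U)%:R * q) <= \prod_(u <- U) (if u == x then q else 1 - q).
Proof.
move=> uU xU /andP[q0 q1]; rewrite (bigD1_seq x) //= eqxx ler_wpM2l //.
have bern m : 1 - m%:R * q <= (1 - q) ^+ m.
  elim: m => [|m IH]; first by rewrite expr0 mul0r subr0.
  have q1' : 0 <= 1 - q by rewrite subr_ge0.
  rewrite exprS; apply: le_trans (ler_wpM2l q1' IH).
  have : 0 <= m%:R * q ^+ 2 by rewrite mulr_ge0 ?sqr_ge0.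
  rewrite -natr1; lra.
apply: le_trans (bern _) _.
rewrite (eq_bigr (fun=> 1 - q)); last by move=> u /negbTE ->.
rewrite big_const_seq iter_mulr_1 ler_wiXn2l ?count_size //; lra.
Qed.

(* Activate the points independently, with probability [1 / (4 #|S|)], and send
   [g] to the first active point of [S^-1 g]: when exactly one point of
   [S^-1 g] and [S^-1 h^-1 g] is active and it lies in both windows, [g] and
   [h^-1 g] get the same center. *)
Lemma center_map (eta : R) : 0 < eta ->
  exists (c : G -> G) (Rg : seq G), (forall g, exists2 r, r \in Rg & c g = (r * g)%g) /\
    forall i, uniform_ub F (fun g => - (c g == c ((hs i)^-1 * g)%g)%:R)
                (eta - 16^-1).
Proof.
move=> eta0; have half0 : 0 < 2^-1 :> R by [].
have [N _ /(_ N (leqnn _)) folN] := folner_near folner_F (codom hs) half0.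
pose S : seq G := F N; pose n := size S.
have uS : uniq S by exact: fset_uniq.
have n0 : 0 < n%:R :> R := folner_card_gt0 folner_F N.
(* The two windows have at most [2 * n] points together, so a given point is the only active one
   with chance at least [q / 2]; at least [n / 2] points lie in both windows, and
   [n / 2 * (q / 2) = 1 / 16]. *)
pose q : R := (4 * n%:R)^-1.
have q01 : 0 <= q <= 1.
  have n1 : 1 <= n%:R :> R by rewrite ler1n -(ltr0n R).
  by apply/andP; split; [rewrite invr_ge0|rewrite invf_le1]; lra.
pose w (b : bool) := if b then q else 1 - q.
have w0 b : 0 <= w b by case/andP: q01 => ? ?; rewrite /w; case: b => //; lra.
have w1 : \sum_b w b = 1 by rewrite big_bool /w /=; lra.
pose L g : seq G := [seq (s^-1 * g)%g | s <- S].
(* Without an active point the center is [g] itself, which is why [1] is put in front of the offsets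
   at the end. *)
pose c (z : G -> bool) g := head g [seq x <- L g | z x].
pose f i g (z : G -> bool) : R := - (c z g == c z ((hs i)^-1 * g)%g)%:R.
pose W : seq G := [seq s^-1%g | s <- S] ++ [seq (s^-1 * (hs i)^-1)%g | s <- S, i <- enum I].
have LW g : {subset L g <= [seq (x * g)%g | x <- W]}.
  move=> v /mapP[s sS ->]; apply: map_f.
  by rewrite mem_cat; apply/orP; left; apply: map_f.
have LhW i g : {subset L ((hs i)^-1 * g)%g <= [seq (x * g)%g | x <- W]}.
  move=> v /mapP[s sS ->]; rewrite mulgA; apply: map_f.
  by rewrite mem_cat; apply/orP; right; apply: allpairs_f; rewrite ?mem_enum.
have c_eq g z z' : {in L g, z =1 z'} -> c z g = c z' g.
  by move=> e; rewrite /c (eq_in_filter (a2 := z')).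
have [] := @derandomize_ub _ _ F countable_G infinite_G folner_F _ w _ f
  (fun _ _ => - 16^-1) W eta w0 w1 _ _ _ _ eta0.
- move=> i g z z' e; rewrite /f (c_eq g z z'); last by move=> v /LW/e.
  by rewrite (c_eq _ z z') // => v /LhW/e.
- by move=> i g z; rewrite /f normrN; case: (_ == _); rewrite ?normr1 ?normr0.
- by move=> i g; rewrite normrN ger0_norm; lra.
- move=> i g vs z uvs sub; set g' := ((hs i)^-1 * g)%g.
  pose U := undup (L g ++ L g'); pose T := [seq s <- S | (s^-1 * g)%g \in L g'].
  pose k s u (b : bool) : R := if u == (s^-1 * g)%g then b%:R else (~~ b)%:R.
  have TS s : s \in T -> (s \in S) && ((s^-1 * g)%g \in L g').
    by rewrite mem_filter andbC.
  have TU s : s \in T -> (s^-1 * g)%g \in U.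
    by move=> /TS/andP[_ sL]; rewrite mem_undup mem_cat sL orbT.
  have uT : uniq T by rewrite filter_uniq.
  (* The products are indicators of the events that one point of [T] alone is active in [U]; they
     are mutually exclusive, and each forces equal centers. *)
  have fP y : f i g y <= \sum_(s <- T) - (\prod_(u <- U) k s u (y u)).
    rewrite sumrN lerN2.
    have [/hasP[s sT /negP nz]|/hasPn allz] :=
      boolP (has (fun s => \prod_(u <- U) k s u (y u) != 0) T); last first.
      by rewrite big_seq big1 // => s /allz /negbNE/eqP.
    have yU u : u \in U -> y u = (u == (s^-1 * g)%g).
      move=> uU; apply/eqP; apply: contrapT => yu; apply: nz.
      rewrite (big_rem u) //= /k; move: yu.
      by case: (u == _); case: (y u); rewrite ?mul0r ?eqxx.
    have act h : {subset L h <= U} -> (s^-1 * g)%g \in L h -> c y h = (s^-1 * g)%g.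
      move=> hU sh; have : (s^-1 * g)%g \in [seq x <- L h | y x].
        by rewrite mem_filter sh yU ?TU // eqxx.
      rewrite /c; case e: [seq _ <- _ | _] => [//|x r] _ /=.
      have : x \in [seq x <- L h | y x] by rewrite e mem_head.
      by rewrite mem_filter => /andP[yx /hU/yU]; rewrite yx => /esym/eqP.
    have /andP[sS sL'] := TS s sT.
    rewrite (act g); [|by move=> v vL; rewrite mem_undup mem_cat vL|exact: map_f].
    rewrite (act g') //; last by move=> v vL; rewrite mem_undup mem_cat vL orbT.
    rewrite eqxx (bigD1_seq s) //= [X in _ + X]big_seq_cond [X in _ + X]big1 ?addr0.
      apply: prodr_ile1 => u _; rewrite /k.
      by case: (u == _); case: (y u) => /=; rewrite ?ler01 ?lexx.
    move=> t /andP[tT ts]; rewrite (big_rem (s^-1 * g)%g) ?TU //= /k.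
    rewrite (inj_eq (@mulIg _ g)) (inj_eq invg_inj) eq_sym (negbTE ts).
    by rewrite yU ?TU // eqxx mul0r.
  apply: le_trans (Ex_le w0 vs z fP) _; rewrite Ex_sum //.
  rewrite (eq_bigr (fun s => - Ex w vs (fun y => \prod_(u <- U) k s u (y u)) z));
    last by move=> s _; rewrite ExN.
  rewrite sumrN lerN2.
  have sU : (size U)%:R <= 2 * n%:R :> R.
    rewrite -natrM ler_nat; apply: leq_trans (size_undup _) _.
    by rewrite size_cat !size_map -/n mul2n addnn.
  have sumk s u : \sum_b w b * k s u b = if u == (s^-1 * g)%g then q else 1 - q.
    by rewrite big_bool /k /w; case: eqP => _ /=; rewrite mulr1 mulr0 ?addr0 ?add0r.
  apply: (@le_trans _ _ (\sum_(s <- T) q / 2)); last first.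
    rewrite [leLHS]big_seq [leRHS]big_seq; apply: ler_sum => s sT.
    rewrite Ex_prod ?undup_uniq //; last first.
      by move=> v; rewrite mem_undup mem_cat => /orP[/LW/sub|/LhW/sub].
    under eq_bigr do rewrite sumk.
    apply: le_trans (prod_one_active (undup_uniq _) (TU s sT) q01).
    have /andP[q0 _] := q01; rewrite ler_wpM2l //.
    have : (size U)%:R * q <= 2 * n%:R * q by rewrite ler_wpM2r.
    rewrite (_ : 2 * n%:R * q = 2^-1); first by lra.
    by rewrite /q; field; rewrite gt_eqF.
  have sT : n%:R <= 2 * (size T)%:R :> R.
    have : (count (fun s => (s^-1 * g)%g \notin L g') S)%:R <= 2^-1 * n%:R :> R.
      apply: le_trans (folN (hs i) (codom_f _ _)); rewrite ler_nat -size_filter.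
      apply: uniq_leq_size; first by rewrite filter_uniq.
      move=> s; rewrite mem_filter => /andP[sL sS].
      rewrite /fset_symdiff inE; apply/orP; right.
      rewrite inE andbC; apply/andP; split=> //; apply: contra sL.
      move=> /imfsetP[t /= tF ->]; apply/mapP; exists t => //.
      by rewrite invgM mulgA.
    have -> : n%:R = (size T)%:R +
        (count (fun s => (s^-1 * g)%g \notin L g') S)%:R :> R.
      by rewrite size_filter -natrD count_predC.
    lra.
  rewrite big_const_seq count_predT iter_addr_0 -[leRHS]mulr_natl.
  have -> : 16^-1 = n%:R / 2 * (q / 2) by rewrite /q; field; rewrite gt_eqF.
  rewrite ler_wpM2r //; last by lra.
  by case/andP: q01 => q0 _; rewrite divr_ge0.
move=> z zP; exists (c z), (1%g :: [seq s^-1%g | s <- S]); split.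
- move=> g; rewrite /c; case e: [seq _ <- _ | _] => [|x r] /=.
    by exists 1%g; rewrite ?mul1g ?mem_head.
  have : x \in [seq x <- L g | z x] by rewrite e mem_head.
  rewrite mem_filter => /andP[_ /mapP[s sS ->]].
  by exists s^-1%g => //; rewrite inE map_f ?orbT.
- move=> i; apply: ub_le (ubD (zP i) (ub_const F (- 16^-1))) => // g.
  by rewrite subrK.
Qed.

End ConcreteSieves.

(** The joint law of finitely many events as a weight on a finite set: it turns the readings of a
    random point of [X] into one coordinate of a product expectation. *)
Lemma pattern_law (R : realType) (d : measure_display) (X : measurableType d)
    (mu : probability X R) (I : finType) (B : I -> set X) :
  (forall i, measurable (B i)) ->
  exists w : {ffun I -> bool} -> R, [/\ forall a, 0 <= w a, \sum_a w a = 1 &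
    forall i j, \sum_a w a * ((a i)%:R * (a j)%:R) = fine (mu (B i `&` B j))].
Proof.
move=> mB; pose pat x := [ffun i => x \in B i].
have matom a : measurable (pat @^-1` [set a]).
  rewrite (_ : _ @^-1` _ = \big[setI/[set: X]]_i (if a i then B i else ~` B i)).
    by apply: bigsetI_measurable => i _; case: ifP => _ //; exact: measurableC.
  rewrite -bigcap_seq; apply/seteqP; split=> [x /= <- i _|x /= xB].
    rewrite /= ffunE; case: ifPn => [/set_mem//|/negP]; by rewrite inE.
  apply/ffunP => i; rewrite ffunE; have := xB i (mem_index_enum i).
  by case: ifP => _ => [/mem_set|xBi]; [|apply/negbTE/negP => /set_mem].
have msum s : uniq s -> measurable [set x | pat x \in s] /\
    fine (mu [set x | pat x \in s]) = \sum_(a <- s) fine (mu (pat @^-1` [set a])).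
  elim: s => [_|a s IH /= /andP[as_ us]].
    rewrite (_ : [set x | _] = set0); last by apply/seteqP; split.
    by rewrite measure0 big_nil.
  have [ms es] := IH us.
  have -> : [set x | pat x \in a :: s] = pat @^-1` [set a] `|` [set x | pat x \in s].
    apply/seteqP; split=> x /=; rewrite inE.
      by case/orP => [/eqP|]; [left|right].
    by case=> [->|->]; rewrite ?eqxx ?orbT.
  split; first exact: measurableU.
  rewrite measureU //; last first.
    apply/seteqP; split=> x //= [] -> as'; by rewrite as' in as_.
  by rewrite fineD ?fin_num_measure // big_cons es.
have law (P : pred {ffun I -> bool}) :
    \sum_(a | P a) fine (mu (pat @^-1` [set a])) = fine (mu [set x | P (pat x)]).
  rewrite -big_filter -(msum _ (filter_uniq _ (index_enum_uniq _))).2.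
  congr (fine (mu _)); apply/seteqP; split=> x /=;
    by rewrite mem_filter mem_index_enum andbT.
exists (fun a => fine (mu (pat @^-1` [set a]))); split=> [a||i j].
- exact: fine_ge0.
- rewrite law (_ : [set x | _] = setT) ?probability_setT //.
  by apply/seteqP; split.
rewrite (eq_bigr (fun a : {ffun I -> bool} => if a i && a j then fine (mu (pat @^-1` [set a])) else 0)).
  rewrite -big_mkcond law; congr (fine (mu _)); apply/seteqP; split=> x /=.
    by rewrite !ffunE => /andP[/set_mem ? /set_mem].
  by rewrite !ffunE => -[? ?]; apply/andP; split; apply/mem_set.
by move=> a _; case: (a i); case: (a j); rewrite /= ?(mulr0, mul0r, mulr1).
Qed.

(** * Random sets read off a measure preserving action *)

Section Actions.
Variables (R : realType) (G : groupType) (d : measure_display)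
  (X : measurableType d) (mu : probability X R) (T : G -> X -> X).
Hypothesis actT : mp_action mu T.

Lemma mp_image (h : G) (B : set X) : T h @` B = T h^-1%g @^-1` B.
Proof.
apply/seteqP; split=> x /= => [[y By <-]|Bx].
  by rewrite -(mp_actionM actT) mulVg (mp_action1 actT).
by exists (T h^-1%g x) => //; rewrite -(mp_actionM actT) mulgV (mp_action1 actT).
Qed.

Lemma mp_preimage_measurable (h : G) (B : set X) : measurable B ->
  measurable (T h @^-1` B).
Proof.
move=> mB; rewrite -[X in measurable X]setTI.
exact: (mp_action_measurable actT).
Qed.

Variables (F : nat -> {fset G}).
Hypotheses (countable_G : countable [set: G]) (infinite_G : infinite_set [set: G])
  (folner_F : folner_sequence R F).
Variables (I : finType) (hs : I -> G) (B : set X).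
Hypothesis mB : measurable B.

(* Every [g] reads the itinerary of an independent random point of [X] placed at
   its center [c g]. *)
Lemma sieve_system (c : G -> G) (Rg : seq G) :
  (forall g, exists2 r, r \in Rg & c g = (r * g)%g) ->
  sieve F hs (fine (mu B)) (fun i g =>
    if c g == c ((hs i)^-1 * g)%g then fine (mu (B `&` T (hs i) @` B))
    else fine (mu B) ^+ 2).
Proof.
move=> cRg.
(* A point [x] placed at the center [r * g] is read by [g] as [T r^-1 x]; one pattern records the
   readings for all offsets [r]. The successor makes the index type inhabited. *)
pose Bs (k : 'I_(size Rg).+1) := T (nth 1%g Rg k)^-1%g @^-1` B.
have mBs k : measurable (Bs k) by exact: mp_preimage_measurable.
have [w [w0 w1 wE]] := pattern_law mu mBs.
have wE1 k : \sum_a w a * (a k)%:R = fine (mu B).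
  rewrite -(mp_action_preserving actT (nth 1%g Rg k)^-1%g mB) -[_ @^-1` _]setIid.
  rewrite -wE; apply: eq_bigr => a _; by case: (a k); rewrite ?mulr1 ?mulr0.
pose ix (g : G) : 'I_(size Rg).+1 := inord (index (c g * g^-1)%g Rg).
have nth_ix g : nth 1%g Rg (ix g) = (c g * g^-1)%g.
  have [r rR cg] := cRg g; have rgR : (c g * g^-1)%g \in Rg by rewrite cg mulgK.
  by rewrite /ix inordK ?nth_index // ltnS ltnW // index_mem.
have fin A : measurable A -> 0 <= fine (mu A) <= 1.
  move=> mA; rewrite fine_ge0 //= -lee_fin fineK ?fin_num_measure //.
  exact: probability_le1.
have mBh h : measurable (B `&` T h @` B).
  by apply: measurableI => //; rewrite mp_image; exact: mp_preimage_measurable.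
have cW g : c g \in [seq (x * g)%g | x <- Rg].
  by have [r rR ->] := cRg g; exact: map_f.
pose D (g : G) (z : G -> {ffun 'I_(size Rg).+1 -> bool}) := z (c g) (ix g).
apply: (@local_sieve _ _ _ countable_G infinite_G folner_F _ _ _ w Rg D) => //.
- by move=> g z z' e; rewrite /D e.
- exact: fin.
- move=> i g; case: ifP => _; first exact: fin.
  by have /andP[? ?] := fin B mB; rewrite exprn_ge0 // exprn_ile1.
- move=> g vs z sub.
  by rewrite (Ex_coord w1 (fun a => (a (ix g))%:R)) ?wE1 // sub.
move=> i g vs z sub subh; set g' := ((hs i)^-1 * g)%g.
have [ce|cne] := eqVneq (c g) (c g').
  rewrite /D -ce (Ex_coord w1 (fun a : {ffun _ -> bool} => (a (ix g))%:R * (a (ix g'))%:R));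
    last by rewrite sub.
  (* With a common center, both readings together form the preimage under [T (g * (c g)^-1)] of the
     intersection of [B] with its image by [T (hs i)]. *)
  rewrite wE -(mp_action_preserving actT (g * (c g)^-1)%g (mBh (hs i))).
  rewrite mp_image preimage_setI /Bs !nth_ix -ce !invgM !invgK le_eqVlt.
  apply/orP; left; apply/eqP; congr (fine (mu (_ `&` _))).
  apply/funext => x; rewrite /preimage /= -(mp_actionM actT).
  by rewrite /g' mulgA.
rewrite /D (Ex_coordM w1 (fun a : {ffun _ -> bool} => (a (ix g))%:R)) ?sub //.
  rewrite (Ex_coord w1 (fun a : {ffun _ -> bool} => (a (ix g'))%:R)) ?subh //.
  by rewrite !wE1.
by move=> z' a; rewrite upd_other // eq_sym.
Qed.

Hypothesis hs_neq1 : forall i, hs i != 1%g.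

(** One shift sieve per element of [H0]. For the other [hs i] the correlation is exactly the square
    of the density, so thinning loses nothing relative to independence. *)
Lemma sieve_shifts (H0 : seq G) : (forall s, s \in H0 -> s != 1%g) ->
  sieve F hs (4^-1 ^+ size H0 : R)
    (fun i _ => (hs i \notin H0)%:R * (16^-1) ^+ size H0).
Proof.
elim: H0 => [_|s H0 IH H01].
  move=> J u eta eta0 u01.
  have [C CP] := sieve_trivial F hs eta0 u01.
  exists C => j; have [c1 c2 c3] := CP j; split=> // i.
  by apply: ub_le (c3 i) => // g; rewrite expr0 mulr1.
have s1 : s != 1%g by apply: H01; rewrite mem_head.
have sh := sieve_shift countable_G infinite_G folner_F hs_neq1 s1.
have {}IH : sieve F hs (4^-1 ^+ size H0 : R)
    (fun i _ => (hs i \notin H0)%:R * (16^-1) ^+ size H0).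
  by apply: IH => t tH; apply: H01; rewrite inE tH orbT.
have pw (x : R) m : 0 <= x <= 1 -> 0 <= x ^+ m <= 1.
  by move=> /andP[? ?]; rewrite exprn_ge0 //= exprn_ile1.
move=> J u eta eta0 u01; have [||C CP] := sieve_mul _ _ sh IH eta0 u01.
- by apply: pw; apply/andP; split; lra.
- move=> i g; have /andP[x0 x1] : 0 <= (16^-1 : R) ^+ size H0 <= 1.
    by apply: pw; apply/andP; split; lra.
  by case: (_ \notin _); rewrite ?mul1r ?mul0r ?x0 ?lexx ?ler01.
exists C => j; have [c1 c2 c3] := CP j; split=> [||i].
- by apply: ub_le c1 => // g; rewrite exprS.
- by apply: ub_le c2 => // g; rewrite exprS.
- apply: ub_le (c3 i) => // g; rewrite inE negb_or exprS -mulnb natrM.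
  by rewrite le_eqVlt; apply/orP; left; apply/eqP; field.
Qed.

(** The product of the thinning sieve and the system sieve. A coincidence of centers saves
    [p ^+ 2 * delta] and has frequency at least 1/16, whence [eps]; for [hs i] in [H0] the
    correlation vanishes and the same saving follows from [delta <= fine (mu B) ^+ 2]. [E0] will be
    the preceding set of a chain, with which interpolation requires no correlation. *)
Lemma random_set (H0 : seq G) (delta : R) (E0 : G -> bool) (eta : R) :
  (forall s, s \in H0 -> s != 1%g) ->
  0 < delta -> delta <= fine (mu B) ^+ 2 ->
  (forall i, hs i \notin H0 ->
     fine (mu (B `&` T (hs i) @` B)) <= fine (mu B) ^+ 2 - delta) ->
  let b := 4^-1 ^+ size H0 * fine (mu B) in
  let eps := 16^-1 ^+ size H0 * delta / 16 in
  0 < eta -> exists E : G -> bool,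
  [/\ uniform_ub F (fun g => (E g)%:R - b) eta,
      uniform_ub F (fun g => b - (E g)%:R) eta &
      forall i,
      [/\ uniform_ub F (fun g => (E g)%:R * (E ((hs i)^-1 * g)%g)%:R) (b ^+ 2 - eps + eta),
          uniform_ub F (fun g => (E g)%:R * (E0 ((hs i)^-1 * g)%g)%:R -
                                 b * (E0 ((hs i)^-1 * g)%g)%:R) eta &
          uniform_ub F (fun g => (E0 g)%:R * (E ((hs i)^-1 * g)%g)%:R -
                                 b * (E0 g)%:R) eta]].
Proof.
move=> H01 d0 da phi_le b eps eta0.
pose a := fine (mu B); pose p : R := 4^-1 ^+ size H0.
have e2 : 0 < eta / 2 by rewrite divr_gt0.
have /andP[a0 a1] : 0 <= a <= 1.
  rewrite fine_ge0 //= -lee_fin fineK ?fin_num_measure //.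
  exact: probability_le1.
have p2E : 16^-1 ^+ size H0 = p ^+ 2.
  by rewrite /p -exprM mulnC exprM; congr (_ ^+ _); field.
have /andP[p0 p1] : 0 <= p <= 1.
  by rewrite exprn_ge0 ?exprn_ile1 //; lra.
have p21 : 0 <= p ^+ 2 <= 1.
  by apply/andP; split; [exact: exprn_ge0|exact: exprn_ile1].
have [c [Rg [cRg cP]]] := center_map countable_G infinite_G folner_F hs e2.
pose same i g : R := (c g == c ((hs i)^-1 * g)%g)%:R.
have phi01 i : 0 <= fine (mu (B `&` T (hs i) @` B)) <= 1.
  have mBh : measurable (B `&` T (hs i) @` B).
    by apply: measurableI => //; rewrite mp_image; exact: mp_preimage_measurable.
  rewrite fine_ge0 //= -lee_fin fineK ?fin_num_measure //.
  exact: probability_le1.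
(* The weight [E0 (hs i * g)] serves the last clause, after a shift by [(hs i)^-1]. *)
pose u (t : option I + I) (g : G) : R := match t with
  | inl None => 1 | inl (Some i) => (E0 (hs i * g)%g)%:R
  | inr i => (E0 ((hs i)^-1 * g)%g)%:R end.
have a01 : 0 <= a <= 1 by rewrite a0 a1.
have r01 i g : 0 <= (if c g == c ((hs i)^-1 * g)%g
    then fine (mu (B `&` T (hs i) @` B)) else a ^+ 2) <= 1.
  by case: ifP => _ //; rewrite exprn_ge0 //= exprn_ile1.
have u01 t g : 0 <= u t g <= 1.
  move: t => [[i|]|i] /=; rewrite ?ler01 ?lexx //; by case: (E0 _); rewrite ?lexx ?ler01.
have [E EP] := sieve_mul a01 r01 (sieve_shifts H01) (sieve_system cRg) e2 u01.
exists E; have [e1 e1' pr] := EP (inl None); split=> [||i].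
- by apply: ub_le e1 => [g|]; rewrite /= ?mulr1 //; lra.
- by apply: ub_le e1' => [g|]; rewrite /= ?mulr1 //; lra.
have [x1 _ _] := EP (inr i); have [x2 _ _] := EP (inl (Some i)); split.
- have /andP[q0 q1] := p21; have pd0 : 0 <= p ^+ 2 * delta by rewrite mulr_ge0 // ltW.
  have pd1 : p ^+ 2 * delta <= 1.
    apply: mulr_ile1 => //; first exact: ltW.
    by apply: le_trans da _; exact: exprn_ile1.
  have ubs := ubD (ubD (pr i) (ub_const F (b ^+ 2))) (ubZ pd0 (cP i)).
  apply: ub_le ubs => [g /=|]; last first.
    rewrite /eps p2E.
    have := ler_wpM2r (ltW e2) pd1; lra.
  rewrite !mulr1 -/a.
  suff : (hs i \notin H0)%:R * 16^-1 ^+ size H0 *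
      (if c g == c ((hs i)^-1 * g)%g then fine (mu (B `&` T (hs i) @` B))
       else a ^+ 2) + p ^+ 2 * delta * same i g <= b ^+ 2.
    rewrite /same; set rr := (_%:R * _ ^+ _ * _). lra.
  rewrite p2E /b -/p -/a exprMn /same.
  have [sH|sH] := boolP (hs i \in H0) => /=.
    rewrite !mul0r add0r -mulrA ler_wpM2l //.
    apply: le_trans da; case: (_ == _); rewrite ?mulr1 ?mulr0 //; exact: ltW.
  rewrite mul1r -mulrA -mulrDr ler_wpM2l //.
  have := phi_le i sH; rewrite -/a.
  by case: (_ == _); rewrite ?mulr1 ?mulr0 ?addr0 //; lra.
- by apply: ub_le x1 => [g|] //; lra.
- have bnd g : `|(E g)%:R * (E0 (hs i * g)%g)%:R - p * a * (E0 (hs i * g)%g)%:R| <= 2.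
    apply: le_trans (ler_normB _ _) _.
    have pa : `|p * a| <= 1 by rewrite ger0_norm ?mulr_ge0 // mulr_ile1.
    by case: (E _); case: (E0 _); rewrite ?(mulr0, mul0r, mulr1, normr0, normr1); lra.
  apply: ub_le (ub_shift folner_F (hs i)^-1%g bnd x2) => [g|]; last by lra.
  by rewrite /= mulVKg [X in X - _ <= _]mulrC.
Qed.

End Actions.

(** * Interpolation and gluing *)

Section Interpolation.
Variables (R : realType) (G : groupType) (F : nat -> {fset G}).
Hypotheses (countable_G : countable [set: G]) (infinite_G : infinite_set [set: G])
  (folner_F : folner_sequence R F).
Variables (I : finType) (hs : I -> G).
Hypothesis hs_neq1 : forall i, hs i != 1%g.

(* Switch from [E0] to [E1] at independent uniform times; since [E1] is
   uncorrelated with [E0], every stage keeps at least half of the negative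
   correlation. *)
Lemma interpolation (E0 E1 : G -> bool) (b eps eta : R) (n : nat) :
  (0 < n)%N -> 0 <= b <= 1 -> 0 <= eps -> 0 < eta ->
  uniform_ub F (fun g => (E0 g)%:R - b) eta ->
  uniform_ub F (fun g => b - (E0 g)%:R) eta ->
  uniform_ub F (fun g => b - (E1 g)%:R) eta ->
  (forall i,
      [/\ uniform_ub F (fun g => (E0 g)%:R * (E0 ((hs i)^-1 * g)%g)%:R)
            (b ^+ 2 - eps + eta),
          uniform_ub F (fun g => (E1 g)%:R * (E1 ((hs i)^-1 * g)%g)%:R)
            (b ^+ 2 - eps + eta),
          uniform_ub F (fun g => (E1 g)%:R * (E0 ((hs i)^-1 * g)%g)%:R -
                                 b * (E0 ((hs i)^-1 * g)%g)%:R) eta &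
          uniform_ub F (fun g => (E0 g)%:R * (E1 ((hs i)^-1 * g)%g)%:R -
                                 b * (E0 g)%:R) eta]) ->
  exists P : nat -> G -> bool, [/\ P 0%N = E0, P n = E1,
    forall m, (m <= n)%N -> uniform_ub F (fun g => - (P m g)%:R) (- b + 2 * eta),
    forall m i, (m <= n)%N ->
      uniform_ub F (fun g => (P m g)%:R * (P m ((hs i)^-1 * g)%g)%:R)
        (b ^+ 2 - eps / 2 + 3 * eta) &
    forall m, (m < n)%N ->
      uniform_ub F (fun g => (P m g != P m.+1 g)%:R) (n%:R^-1 + eta)].
Proof.
move=> n0 /andP[b0 b1] eps0 eta0 u0 u0' u1' pr.
have n0' : 0 < n%:R :> R by rewrite ltr0n.
pose w (a : 'I_n) : R := n%:R^-1.
have w0 a : 0 <= w a by rewrite /w invr_ge0 ltW.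
have w1 : \sum_a w a = 1.
  by rewrite sumr_const card_ord -[LHS]mulr_natl divff // gt_eqF.
pose t (m : nat) : R := m%:R / n%:R.
have t01 m : (m <= n)%N -> 0 <= t m <= 1.
  move=> mn; rewrite /t divr_ge0 //= ler_pdivrMr // mul1r ler_nat //.
have wif m (x y : R) : (m <= n)%N ->
    \sum_a w a * (if (a < m)%N then x else y) = t m * x + (1 - t m) * y.
  move=> mn.
  have ct : \sum_(a < n) (if (a < m)%N then 1 else 0) = m%:R :> R.
    by rewrite -big_mkcond -(big_ord_widen n (fun=> 1) mn) sumr_const card_ord.
  rewrite -mulr_sumr.
  have -> : \sum_(a < n) (if (a < m)%N then x else y) = m%:R * (x - y) + n%:R * y.
    rewrite -ct mulr_suml -[n in n%:R * y]card_ord mulr_natl -sumr_const -big_split /=.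
    by apply: eq_bigr => a _; case: ifP => _; ring.
  by rewrite /t; field; rewrite gt_eqF.
pose Q m g (z : G -> 'I_n) := if (z g < m)%N then E1 g else E0 g.
pose mQ m g : R := t m * (E1 g)%:R + (1 - t m) * (E0 g)%:R.
pose k m g (a : 'I_n) : R := if (a < m)%N then (E1 g)%:R else (E0 g)%:R.
have QE m g z : (Q m g z)%:R = k m g (z g) by rewrite /Q /k; case: ifP.
pose J : finType := ('I_n.+1 + 'I_n.+1 * I + 'I_n)%type.
pose f (j : J) g z : R := match j with
  | inl (inl m) => - (Q m g z)%:R
  | inl (inr (m, i)) => (Q m g z)%:R * (Q m ((hs i)^-1 * g)%g z)%:R
  | inr m => (z g == m)%:R end.
pose mean (j : J) g : R := match j with
  | inl (inl m) => - mQ m g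
  | inl (inr (m, i)) => mQ m g * mQ m ((hs i)^-1 * g)%g
  | inr m => n%:R^-1 end.
pose W : seq G := 1%g :: [seq (hs i)^-1%g | i <- enum I].
have gW g : g \in [seq (x * g)%g | x <- W] by rewrite /= mul1g mem_head.
have hW i g : ((hs i)^-1 * g)%g \in [seq (x * g)%g | x <- W].
  apply: (map_f (fun x => (x * g)%g)); rewrite inE; apply/orP; right.
  by apply: (map_f (fun i => (hs i)^-1%g)); rewrite mem_enum.
have mQ01 m g : (m <= n)%N -> 0 <= mQ m g <= 1.
  move=> /t01/andP[x0 x1]; rewrite /mQ.
  by case: (E1 g); case: (E0 g); rewrite ?mulr1 ?mulr0; lra.
have [] := @derandomize_ub _ _ F countable_G infinite_G folner_F _ w _ f mean W
  eta w0 w1 _ _ _ _ eta0.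
- move=> j g z z' e; have eg := e _ (gW g); have eh i := e _ (hW i g).
  by case: j => [[m|[m i]]|m] /=; rewrite /Q ?eg ?eh.
- have B01 (x y : bool) : `|x%:R * y%:R : R| <= 1.
    by case: x; case: y; rewrite ?(mulr0, mulr1, normr0, normr1).
  case=> [[m|[m i]]|m] g z //=; rewrite ?normrN.
    by have := B01 (Q m g z) true; rewrite mulr1.
  by have := B01 (z g == m) true; rewrite mulr1.
- case=> [[m|[m i]]|m] g /=; rewrite ?normrN.
  + by have /andP[? ?] := mQ01 m g (ltnSE (ltn_ord m)); rewrite ger0_norm.
  + have /andP[? ?] := mQ01 m g (ltnSE (ltn_ord m)).
    have /andP[? ?] := mQ01 m ((hs i)^-1 * g)%g (ltnSE (ltn_ord m)).
    by rewrite ger0_norm ?mulr_ge0 // mulr_ile1.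
  + by rewrite ger0_norm ?invr_ge0 ?(ltW n0') // invf_le1 // ler1n.
- case=> [[m|[m i]]|m] g vs z _ sub /=.
  + have mn := ltnSE (ltn_ord m).
    rewrite ExN // lerN2 [leRHS](_ : _ = Ex w vs (fun z => k m g (z g)) z);
      last by apply: eq_Ex => y; rewrite -QE.
    by rewrite (Ex_coord w1 (k m g)) ?sub // wif.
  + have mn := ltnSE (ltn_ord m).
    have gh : g != ((hs i)^-1 * g)%g.
      by rewrite -[X in X != _]mul1g (inj_eq (@mulIg _ g)) eq_sym eqg_invLR invg1.
    rewrite [leLHS](_ : _ = Ex w vs (fun z => k m g (z g) *
        k m ((hs i)^-1 * g)%g (z ((hs i)^-1 * g)%g)) z);
      last by apply: eq_Ex => y; rewrite -!QE.
    rewrite (Ex_coordM w1 (k m g)) ?sub //; last first.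
      by move=> y a; rewrite upd_other // eq_sym.
    by rewrite (Ex_coord w1 (k m _)) ?sub // !wif.
  + rewrite (Ex_coord w1 (fun a => (a == m)%:R)) ?sub // (bigD1 m) //= eqxx mulr1.
    by rewrite big1 ?addr0 // => a /negbTE ->; rewrite mulr0.
move=> z zP; exists (fun m g => Q m g z); split.
- by apply/funext => g; rewrite /Q ltn0.
- by apply/funext => g; rewrite /Q ltn_ord.
- move=> m mn; have /andP[x0 x1] := t01 m mn; have x1' : 0 <= 1 - t m by lra.
  have mI : (m < n.+1)%N by [].
  apply: ub_le (ubD (ubD (zP (inl (inl (Ordinal mI)))) (ub_const F (- b)))
    (ubD (ubZ x0 u1') (ubZ x1' u0'))) => [g|]; last by lra.
  by rewrite /= /mQ; lra.
- move=> m i mn; have /andP[x0 x1] := t01 m mn; have x1' : 0 <= 1 - t m by lra.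
  have mI : (m < n.+1)%N by [].
  have [p0 p1 c10 c01] := pr i.
  have bnd g : `|(E0 g)%:R - b| <= 1.
    by rewrite ler_norml; case: (E0 g) => /=; apply/andP; split; lra.
  have u0s := ub_shift folner_F (hs i)^-1%g bnd u0.
  have cross := ubD (ubD c10 (ubZ b0 u0s)) (ubD c01 (ubZ b0 u0)).
  have ts0 : 0 <= t m * (1 - t m) by rewrite mulr_ge0.
  apply: ub_le (ubD (ubD (zP (inl (inr (Ordinal mI, i))))
      (ubD (ubZ (sqr_ge0 (t m)) p1) (ubZ (sqr_ge0 (1 - t m)) p0)))
    (ubD (ubZ ts0 cross) (ub_const F (2 * (t m * (1 - t m)) * b ^+ 2)))) => [g|].
    by rewrite /= /mQ; lra.
  (* Up to [eta], the correlation at time [t] is [b ^ 2 - eps * (t ^ 2 + (1 - t) ^ 2)], and [t ^ 2 +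
     (1 - t) ^ 2 = 1 - 2 * t * (1 - t) >= 1 / 2]. *)
  have ts1 : t m * (1 - t m) <= 4^-1 by have := sqr_ge0 (t m - 2^-1); lra.
  have tsb : t m * (1 - t m) * b <= 4^-1 by have := ler_wpM2r b0 ts1; lra.
  have := ler_wpM2r (ltW eta0) tsb; have := ler_wpM2r eps0 ts1; lra.
- move=> m mn; apply: ub_le (ubD (zP (inr (Ordinal mn))) (ub_const F n%:R^-1))
    => [g|]; last by lra.
  rewrite /= subrK /Q ltnS -val_eqE /=.
  case: (ltngtP (z g) m) => _; rewrite ?eqxx //.
  by case: (_ != _); rewrite ?ler01.
Qed.

End Interpolation.

(** * An infinite chain of slowly changing sets *)

Section Chain.
Variables (R : realType) (G : groupType) (d : measure_display)
  (X : measurableType d) (mu : probability X R) (T : G -> X -> X).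
Hypothesis actT : mp_action mu T.
Variables (F : nat -> {fset G}).
Hypotheses (countable_G : countable [set: G]) (infinite_G : infinite_set [set: G])
  (folner_F : folner_sequence R F).
Variables (B : set X) (H0 : seq G) (delta : R) (e : nat -> G).
Hypotheses (mB : measurable B) (H0_neq1 : forall s, s \in H0 -> s != 1%g)
  (delta_gt0 : 0 < delta) (delta_le : delta <= fine (mu B) ^+ 2)
  (e_neq1 : forall i, e i != 1%g)
  (e_small : forall i, e i \notin H0 ->
     fine (mu (B `&` T (e i) @` B)) <= fine (mu B) ^+ 2 - delta).

Let b := 4^-1 ^+ size H0 * fine (mu B).
Let eps := 16^-1 ^+ size H0 * delta / 16.

(** Block [k] consists of [n] interpolation steps, from a set good for the first [k] elements of [e]
    to one good for the first [k.+1]. The bounds stay fixed while the controlled part of [e]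
    grows. *)
Lemma chain (eta : R) (n : nat) : 0 < eta -> (0 < n)%N ->
  exists P : nat -> G -> bool,
  [/\ forall m, uniform_ub F (fun g => - (P m g)%:R) (- b + 2 * eta),
      forall m i, (i < m %/ n)%N ->
        uniform_ub F (fun g => (P m g)%:R * (P m ((e i)^-1 * g)%g)%:R)
          (b ^+ 2 - eps / 2 + 3 * eta) &
      forall m, uniform_ub F (fun g => (P m g != P m.+1 g)%:R) (n%:R^-1 + eta)].
Proof.
move=> eta0 n0.
have mu01 : 0 <= fine (mu B) <= 1.
  rewrite fine_ge0 //= -lee_fin fineK ?fin_num_measure //.
  exact: probability_le1.
have b01 : 0 <= b <= 1.
  case/andP: mu01 => x0 x1; rewrite /b mulr_ge0 ?exprn_ge0 ?mulr_ile1 ?exprn_ge0 //.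
  by rewrite exprn_ile1 //; lra.
have eps0 : 0 <= eps by rewrite /eps !mulr_ge0 ?exprn_ge0 ?ltW.
pose good k (E : G -> bool) :=
  [/\ uniform_ub F (fun g => (E g)%:R - b) eta,
      uniform_ub F (fun g => b - (E g)%:R) eta &
      forall i, (i < k)%N ->
        uniform_ub F (fun g => (E g)%:R * (E ((e i)^-1 * g)%g)%:R) (b ^+ 2 - eps + eta)].
pose link k (E E' : G -> bool) (Q : nat -> G -> bool) :=
  [/\ Q 0%N = E, Q n = E',
    forall m, (m <= n)%N -> uniform_ub F (fun g => - (Q m g)%:R) (- b + 2 * eta),
    forall m i, (m <= n)%N -> (i < k)%N ->
      uniform_ub F (fun g => (Q m g)%:R * (Q m ((e i)^-1 * g)%g)%:R)
        (b ^+ 2 - eps / 2 + 3 * eta) &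
    forall m, (m < n)%N ->
      uniform_ub F (fun g => (Q m g != Q m.+1 g)%:R) (n%:R^-1 + eta)].
have rnd k E0 := @random_set R G d X mu T actT F countable_G infinite_G folner_F
  'I_k (fun i => e i) B mB (fun i => e_neq1 i) H0 delta E0 eta H0_neq1 delta_gt0
  delta_le (fun i => @e_small i) eta0.
(* The new set is drawn for [k.+1] elements, but the block controls only the [k] elements that [E]
   controls. The premise [good] sits under the existential so that [choice] gives a total
   function. *)
have step (kE : nat * (G -> bool)) : exists EQ : (G -> bool) * (nat -> G -> bool),
    good kE.1 kE.2 -> good kE.1.+1 EQ.1 /\ link kE.1 kE.2 EQ.1 EQ.2.
  case: kE => k E; have [[gE1 gE2 gE3]|bad] := pselect (good k E); last first.
    by exists (E, fun=> E) => /bad.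
  have [E' [g1 g2 pr]] := rnd k.+1 E.
  have pr' (i : nat) (ik : (i < k.+1)%N) := pr (Ordinal ik).
  have [i|Q [q1 q2 q3 q4 q5]] := interpolation countable_G infinite_G folner_F
    (hs := fun i : 'I_k => e i) (fun i => e_neq1 i) (E0 := E) (E1 := E') n0 b01 eps0
    eta0 gE1 gE2 g2.
    have [x1 x2 x3] := pr' i (ltnW (ltn_ord i)).
    by split=> //; exact: gE3.
  exists (E', Q) => _; split; split=> //=.
    by move=> i ik; have [] := pr' i ik.
  by move=> m i mn ik; exact: (q4 m (Ordinal ik) mn).
have [next nextP] := choice step.
have [E0 [g1 g2 _]] := rnd 0%N (fun=> false).
pose S := fix S k := if k is k'.+1 then (next (k', S k')).1 else E0.
have gS k : good k (S k).
  elim: k => [|k IH]; first by split.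
  by have [] := nextP (k, S k) IH.
have lS k : link k (S k) (S k.+1) (next (k, S k)).2.
  by have [] := nextP (k, S k) (gS k).
exists (fun m => (next (m %/ n, S (m %/ n))%N).2 (m %% n)%N); split.
- move=> m; have [_ _ l _ _] := lS (m %/ n)%N; apply: l.
  by rewrite ltnW // ltn_pmod.
- move=> m i im; have [_ _ _ l _] := lS (m %/ n)%N; apply: l => //.
  by rewrite ltnW // ltn_pmod.
move=> m; have [_ lE _ _ /(_ _ (ltn_pmod m n0)) l] := lS (m %/ n)%N.
have [mn|mn] := ltnP (m %% n).+1 n.
  have em : (m.+1 = m %/ n * n + (m %% n).+1)%N by rewrite addnS -divn_eq.
  have -> : (m.+1 %/ n = m %/ n)%N by rewrite {1}em divnMDl // (divn_small mn) addn0.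
  by have -> : (m.+1 %% n = (m %% n).+1)%N by rewrite {1}em modnMDl (modn_small mn).
(* At the end of a block the last stage is [S k.+1], which is stage 0 of the next block. *)
have en : (m %% n).+1 = n by apply/eqP; rewrite eqn_leq mn ltn_pmod.
have em : (m.+1 = (m %/ n).+1 * n)%N by rewrite mulSn {1}(divn_eq m n) -addnS en addnC.
have -> : (m.+1 %/ n = (m %/ n).+1)%N by rewrite em mulnK.
have -> : (m.+1 %% n = 0)%N by rewrite em modnMl.
have [-> _ _ _ _] := lS (m %/ n).+1.
by move: l; rewrite en lE.
Qed.

End Chain.

(** * Windows in large Folner sets and the glued set *)

Section Gluing.
Variables (R : realType) (G : groupType) (F : nat -> {fset G}).
Hypotheses (infinite_G : infinite_set [set: G]) (folner_F : folner_sequence R F).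

Lemma near_forall_lt (n : nat) (Q : nat -> nat -> Prop) :
  (forall i, (i < n)%N -> \forall N \near \oo, Q i N) ->
  \forall N \near \oo, forall i, (i < n)%N -> Q i N.
Proof.
elim: n => [_|n IH nearQ]; first by near=> N.
have near1 := IH (fun i ni => nearQ i (ltnW ni)).
have near2 := nearQ n (ltnSn n).
near=> N; move=> i; rewrite ltnS leq_eqVlt => /orP[/eqP ->|]; first by near: N.
by move: i; near: N.
Unshelve. all: by end_near. Qed.

(** A small set almost invariant under [S] is exactly invariant, since its symmetric differences
    have fewer than one element; it then contains a right translate of [S]. *)
Lemma folner_card_ge (C : nat) : \forall N \near \oo, (C <= #|` F N|)%N.
Proof.
have [S uS sS] := infinite_uniq_seq C infinite_G.
have e0 : 0 < (C.+1%:R)^-1 :> R by rewrite invr_gt0.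
have nearS := folner_near folner_F S e0.
near=> N; rewrite leqNgt; apply/negP => FC.
have inv : {in S, forall s, fset_symdiff (fset_ltranslate s (F N)) (F N) = fset0}.
  move=> s sS'; apply/eqP; rewrite -cardfs_eq0 -leqn0 -ltnS -(ltr_nat R).
  have : #|` fset_symdiff (fset_ltranslate s (F N)) (F N)|%:R <=
      C.+1%:R^-1 * #|` F N|%:R :> R by apply: (near nearS N).
  move/le_lt_trans; apply; rewrite mulrC ltr_pdivrMr // mul1r ltr_nat.
  exact: ltnW.
have [x xF] : exists x, x \in F N by apply/fset0Pn; case: folner_F.
suff : (size S <= #|` F N|)%N by rewrite sS leqNgt FC.
rewrite -(size_map (fun s => (s * x)%g)); apply: uniq_leq_size.
  by rewrite map_inj_uniq //; exact: mulIg.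
move=> y /mapP[s sS' ->]; apply: contraT => sxF.
have : (s * x)%g \in fset_symdiff (fset_ltranslate s (F N)) (F N).
  rewrite /fset_symdiff inE; apply/orP; left; rewrite inE sxF /=.
  by apply/imfsetP; exists x.
by rewrite inv // inE.
Unshelve. all: by end_near. Qed.

(** Double counting as in [ub_scale], but the comparison with [psi] may fail at centers in [A].
    Invariance costs one [eta]; the exceptional centers cost two, because [1 <= m + 2]. *)
Lemma window_average (f psi : G -> R) (S A : seq G) (m eta : R) N :
  (0 < size S)%N -> 0 <= eta -> -1 <= m -> (forall x, `|f x| <= 1) ->
  {in S, forall s, #|` fset_symdiff (fset_ltranslate s (F N)) (F N)|%:R <=
    eta * #|` F N|%:R} ->
  (size A)%:R <= eta * #|` F N|%:R ->
  (forall c, \sum_(s <- S) psi (s * c)%g <= m * (size S)%:R) ->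
  (forall c s, c \in F N -> c \notin A -> s \in S -> f (s * c)%g <= psi (s * c)%g) ->
  \sum_(c <- F N) f c <= (m + 3 * eta) * #|` F N|%:R.
Proof.
move=> S0 eta0 m1 f1 inv sA psiS fpsi.
have n0 : 0 < (size S)%:R :> R by rewrite ltr0n.
have cst (s : seq G) (x : R) : \sum_(i <- s) x = (size s)%:R * x.
  by rewrite big_const_seq count_predT iter_addr_0 mulr_natl.
rewrite -(ler_pM2l n0).
apply: (@le_trans _ _ (\sum_(s <- S) (\sum_(c <- F N) f (s * c)%g +
    eta * #|` F N|%:R))).
  rewrite -cst [leLHS]big_seq [leRHS]big_seq; apply: ler_sum => s sS.
  have := folner_shift_sum F s N f1; rewrite distrC ler_norml => /andP[_].
  have := inv s sS; lra.
rewrite big_split /= cst exchange_big /=.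
have : \sum_(c <- F N) \sum_(s <- S) f (s * c)%g <=
    \sum_(c <- F N) (m * (size S)%:R + (c \in A)%:R * (2 * (size S)%:R)).
  rewrite [leLHS]big_seq [leRHS]big_seq; apply: ler_sum => c cF.
  have [cA|cA] := boolP (c \in A).
    rewrite mul1r; apply: (@le_trans _ _ (\sum_(s <- S) 1)).
      by apply: ler_sum => s _; have := f1 (s * c)%g; rewrite ler_norml => /andP[].
    by rewrite cst mulr1; have := ler_wpM2r (ltW n0) m1; lra.
  rewrite mul0r addr0; apply: le_trans (psiS c).
  by rewrite [leLHS]big_seq [leRHS]big_seq; apply: ler_sum => s sS; exact: fpsi.
have : \sum_(c <- F N) (c \in A)%:R <= eta * #|` F N|%:R.
  apply: le_trans sA; rewrite -natr_sum ler_nat -[leqLHS]big_mkcond sum1_count.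
  rewrite -size_filter; apply: uniq_leq_size; first by rewrite filter_uniq.
  by move=> x; rewrite mem_filter => /andP[].
rewrite big_split /= -!mulr_suml sum_const_fset.
set y := \sum_(_ <- _) _ => ya.
have : y * (2 * (size S)%:R) <= eta * #|` F N|%:R * (2 * (size S)%:R).
  by rewrite ler_wpM2r // mulr_ge0.
lra.
Qed.

End Gluing.

Section GluingTheorem.
Variables (R : realType) (G : groupType) (F : nat -> {fset G}).
Hypotheses (infinite_G : infinite_set [set: G]) (folner_F : folner_sequence R F).
Variables (P : nat -> G -> bool) (e : nat -> G) (kappa : nat -> nat)
  (beta gamma tau eta : R).
Hypotheses (eta_gt0 : 0 < eta) (beta_le1 : beta <= 1) (gamma_ge : -1 <= gamma)
  (tau_ge0 : 0 <= tau) (kappa_oo : forall i, exists k0, forall k, (k0 <= k)%N -> (i < kappa k)%N)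
  (P_dens : forall m, uniform_ub F (fun g => - (P m g)%:R) (- beta))
  (P_corr : forall m i, (i < kappa m)%N ->
     uniform_ub F (fun g => (P m g)%:R * (P m ((e i)^-1 * g)%g)%:R) gamma)
  (P_step : forall m, uniform_ub F (fun g => (P m g != P m.+1 g)%:R) tau).

Let D k g : R := (P k g != P k.+1 g)%:R + (P k.+1 g != P k.+2 g)%:R +
  (P k.+2 g != P k.+3 g)%:R.

Let D_ge0 k g : 0 <= D k g.
Proof. by rewrite !addr_ge0. Qed.

Let close k j g : (k <= j)%N -> (j <= k.+3)%N ->
  (P j g)%:R <= (P k g)%:R + D k g /\ (P k g)%:R <= (P j g)%:R + D k g.
Proof.
move=> kj; rewrite -(subnKC kj) -[k.+3]addn3 leq_add2l.
case: (j - k)%N => [|[|[|[|//]]]] _; rewrite ?addn0 ?addn1 ?addn2 ?addn3.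
- by have := D_ge0 k g; lra.
- rewrite /D; case: (P k g); case: (P k.+1 g); case: (P k.+2 g);
    by case: (P k.+3 g) => /=; lra.
- rewrite /D; case: (P k g); case: (P k.+1 g); case: (P k.+2 g);
    by case: (P k.+3 g) => /=; lra.
- rewrite /D; case: (P k g); case: (P k.+1 g); case: (P k.+2 g);
    by case: (P k.+3 g) => /=; lra.
Qed.

(** [psi] and [phi] will dominate minus the indicator of the glued set and its correlation product,
    wherever the sites read lie in shells [k] to [k.+3]. *)
Let psi k g : R := - (P k g)%:R + D k g.
Let phi k i g : R := (P k g)%:R * (P k ((e i)^-1 * g)%g)%:R + D k g +
  D k ((e i)^-1 * g)%g.

Let scale k : exists M,
  (forall c, \sum_(s <- F M) psi k (s * c)%g <= (- beta + 3 * tau + eta) * (size (F M))%:R) /\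
  (forall i c, (i < kappa k)%N ->
    \sum_(s <- F M) phi k i (s * c)%g <= (gamma + 6 * tau + eta) * (size (F M))%:R).
Proof.
have ubDk := ubD (ubD (P_step k) (P_step k.+1)) (P_step k.+2).
have bnd g : `|D k g| <= 3.
  rewrite ger0_norm // /D.
  by case: (_ != _); case: (_ != _); case: (_ != _) => /=; lra.
have near1 := ubD (P_dens k) ubDk eta_gt0.
have near2 := near_forall_lt (fun i (ik : (i < kappa k)%N) =>
  ubD (ubD (P_corr ik) ubDk) (ub_shift folner_F (e i)^-1%g bnd ubDk) eta_gt0).
have [M [M1 M2]] := filter_ex (filterI near1 near2).
exists M; split=> [c|i c ik].
- apply: le_trans (M1 c) _; rewrite ler_wpM2r //; lra.
- apply: le_trans (M2 i ik c) _; rewrite ler_wpM2r //; lra.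
Qed.

(* [E] is [P k] on the [k]-th shell of an exhaustion [A]; the shells are so thick
   that for [nu_k <= N < nu_(k+1)] the set [F N] lies in [A (k + 3)], is almost
   disjoint from [A (k + 1)], and all windows at the scale of level [k] centered
   there only meet the shells [k], ..., [k + 3]. *)
Theorem glue : exists E : G -> bool,
  (\forall N \near \oo,
     (beta - 3 * tau - 4 * eta) * #|` F N|%:R <= \sum_(x <- F N) (E x)%:R) /\
  (forall i, \forall N \near \oo,
     \sum_(x <- F N) (E x)%:R * (E ((e i)^-1 * x)%g)%:R <=
     (gamma + 6 * tau + 4 * eta) * #|` F N|%:R).
Proof.
have [M MP] := choice scale.
pose Th k : seq G := F (M k) ++ [seq ((e i)^-1 * s)%g | i <- iota 0 (kappa k), s <- F (M k)].
(* The sites read at levels up to [j], with inverses: these prevent a window centered outside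
   [A k.+1] from reaching into [A k]. *)
pose T j : seq G := flatten [seq Th k ++ [seq s^-1%g | s <- Th k] | k <- iota 0 j.+1].
have ThT k j s : (k <= j)%N -> s \in Th k -> s \in T j /\ s^-1%g \in T j.
  move=> kj sTh; have kI : k \in iota 0 j.+1 by rewrite mem_iota.
  have inT x : x \in Th k ++ [seq s^-1%g | s <- Th k] -> x \in T j.
    move=> xk; apply/flattenP; eexists; last exact: xk.
    by apply/mapP; exists k.
  by split; apply: inT; rewrite mem_cat ?sTh // (map_f (fun s => s^-1%g)) ?orbT.
(* Beyond [nu] the set [A] fills at most a share [eta] of [F N], which is almost invariant under the
   level window; the clause [kA.1 <= N] makes the thresholds tend to infinity. *)
have nuP (kA : nat * seq G) : exists nu, forall N, (nu <= N)%N ->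
    [/\ (kA.1 <= N)%N, (size kA.2)%:R <= eta * #|` F N|%:R &
    {in F (M kA.1), forall s,
      #|` fset_symdiff (fset_ltranslate s (F N)) (F N)|%:R <= eta * #|` F N|%:R}].
  case: kA => k A /=.
  have near1 := folner_card_ge infinite_G folner_F
    (Num.truncn ((size A)%:R / eta)).+1.
  have near2 := folner_near folner_F (F (M k)) eta_gt0.
  have [nu _ nuP] := filterI (filterI (nbhs_infty_ge k) near1) near2.
  exists nu => N /nuP[[kN cN] iN]; split=> //.
  rewrite mulrC -ler_pdivrMr //; apply: le_trans (ltW (truncnS_gt _)) _.
  by rewrite ler_nat.
have [nu {}nuP] := choice nuP.
(* Level [k] must make [A k.+1] negligible, so its threshold is [nu (k, A k.+1)]; this is the case
   [i = k.+1], and each [F N] below that threshold lies in [A k.+2]. *)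
pose A := fix A j : seq G := if j is i.+1 then
  A i ++ [seq (t * x)%g | t <- T i, x <- A i] ++
  flatten [seq (F N : seq G) | N <- iota 0 (nu (i.-1, A i))] else [::].
have AS i x : x \in A i -> x \in A i.+1 by move=> xA; rewrite /= mem_cat xA.
have Amono i j x : (i <= j)%N -> x \in A i -> x \in A j.
  move=> /subnK <-; elim: (j - i)%N => [//|k IH] xA; rewrite addSn.
  exact/AS/IH.
have AT i t x : t \in T i -> x \in A i -> (t * x)%g \in A i.+1.
  by move=> tT xA; rewrite /= !mem_cat (allpairs_f (fun t x => (t * x)%g)) ?orbT.
have AF i N x : (N < nu (i.-1, A i))%N -> x \in F N -> x \in A i.+1.
  move=> Nnu xF; rewrite /= !mem_cat; apply/orP; right; apply/orP; right.
  apply/flattenP; exists (F N : seq G) => //; apply/mapP; exists N => //.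
  by rewrite mem_iota.
(* Points outside every [A i] get [false]. *)
pose E x := `[< exists i, [/\ x \in A i.+1, x \notin A i & P i x] >].
have E_level i x : x \in A i.+1 -> x \notin A i -> E x = P i x.
  move=> xA xNA; apply/asboolP/idP => [[j [jA jNA Pj]]|Px]; last by exists i.
  suff -> : i = j by [].
  apply/eqP; rewrite eqn_leq; apply/andP; split; rewrite leqNgt; apply/negP => ij.
    by move: xNA; rewrite (Amono j.+1).
  by move: jNA; rewrite (Amono i.+1).
have E_close k c s : c \in A k.+3 -> c \notin A k.+1 -> s \in Th k ->
    (E (s * c)%g)%:R <= (P k (s * c)%g)%:R + D k (s * c)%g /\
    (P k (s * c)%g)%:R <= (E (s * c)%g)%:R + D k (s * c)%g.
  move=> cA cNA sTh; set y := (s * c)%g.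
  have yA : y \in A k.+4.
    by apply: AT => //; have [] := ThT k k.+3 s (leqW (leqW (leqnSn k))) sTh.
  have yNA : y \notin A k.
    apply: contra cNA => yA'; rewrite -(mulKg s c).
    by apply: AT => //; have [] := ThT k k s (leqnn k) sTh.
  have [j [kj jk jA jNA]] : exists j, [/\ (k <= j)%N, (j <= k.+3)%N, y \in A j.+1 & y \notin A j].
    have k1 := leqnSn k; have k2 := leqW k1; have k3 := leqW k2.
    have [y1|y1] := boolP (y \in A k.+1).
      by exists k; split; rewrite // ?ltnS ?k1 ?k2 ?k3.
    have [y2|y2] := boolP (y \in A k.+2).
      by exists k.+1; split; rewrite // ?ltnS ?k1 ?k2 ?k3.
    have [y3|y3] := boolP (y \in A k.+3).
      by exists k.+2; split; rewrite // ?ltnS ?k1 ?k2 ?k3.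
    by exists k.+3; split; rewrite // ?ltnS ?k1 ?k2 ?k3.
  by rewrite (E_level j) //; exact: close.
(* [nu] need not be monotone: the least admissible [k] either satisfies [nu (k, A k.+1) <= N] by
   minimality or equals [k0], whose threshold [N] exceeds. *)
have locate k0 : \forall N \near \oo, exists2 k, (k0 <= k)%N &
    (nu (k, A k.+1) <= N)%N && (N < nu (k.+1, A k.+2))%N.
  near=> N; have exk : exists k, (k0 <= k)%N && (N < nu (k.+1, A k.+2))%N.
    exists (maxn k0 N); rewrite leq_maxl /=.
    have [/= le _ _] := nuP ((maxn k0 N).+1, A (maxn k0 N).+2) _ (leqnn _).
    by apply: leq_trans le; rewrite ltnS leq_maxr.
  case: (ex_minnP exk) => k /andP[k0k kN] kmin; exists k => //.
  rewrite kN andbT; case: (ltngtP k0 k) k0k => // [lt _|<- _]; last first.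
    by near: N; exact: nbhs_infty_ge.
  case: k lt kN kmin => [//|k] lt kN kmin; rewrite leqNgt; apply/negP => Nk.
  by have := kmin k; rewrite -ltnS lt Nk ltnn => /(_ isT).
have bound k N (f Psi : G -> R) (m : R) :
    (nu (k, A k.+1) <= N)%N && (N < nu (k.+1, A k.+2))%N ->
    -1 <= m -> (forall x, `|f x| <= 1) ->
    (forall c, \sum_(s <- F (M k)) Psi (s * c)%g <= m * (size (F (M k)))%:R) ->
    (forall c s, c \in A k.+3 -> c \notin A k.+1 -> s \in F (M k) ->
      f (s * c)%g <= Psi (s * c)%g) ->
    \sum_(c <- F N) f c <= (m + 3 * eta) * #|` F N|%:R.
  move=> /andP[/nuP[_ sA inv] Nk] m1 f1 Psim fPsi.
  have sz : (0 < size (F (M k)))%N by rewrite -(ltr0n R); exact: folner_card_gt0.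
  apply: (window_average sz (ltW eta_gt0) m1 f1 inv sA Psim) => c s cF cA sF.
  by apply: fPsi => //; apply: AF cF.
have sTh k s : s \in F (M k) -> s \in Th k by move=> sF; rewrite mem_cat sF.
exists E; split.
  have loc0 := locate 0%N; near=> N.
  have [k _ kN] : exists2 k, (0 <= k)%N &
    (nu (k, A k.+1) <= N)%N && (N < nu (k.+1, A k.+2))%N by near: N.
  have [Mk _] := MP k.
  have : \sum_(c <- F N) - (E c)%:R <= (- beta + 3 * tau + eta + 3 * eta) * #|` F N|%:R :> R.
    apply: (bound k N _ (psi k)) => // [|x|c s cA cNA /sTh sk].
    - move: beta_le1 tau_ge0 eta_gt0; lra.
    - by rewrite normrN; case: (E x); rewrite ?normr1 ?normr0.
    - have [] := E_close k c s cA cNA sk; rewrite /psi; lra.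
  rewrite sumrN; lra.
move=> i; have [k0 k0P] := kappa_oo i; have lock := locate k0; near=> N.
have [k k0k kN] : exists2 k, (k0 <= k)%N &
  (nu (k, A k.+1) <= N)%N && (N < nu (k.+1, A k.+2))%N by near: N.
have [_ Mk] := MP k; have ik := k0P k k0k.
apply: (@le_trans _ _ ((gamma + 6 * tau + eta + 3 * eta) * #|` F N|%:R)); last first.
  by rewrite ler_wpM2r //; lra.
apply: (bound k N _ (phi k i)) => // [|x|c|c s cA cNA sF].
- move: gamma_ge tau_ge0 eta_gt0; lra.
- by case: (E x); case: (E _); rewrite ?(mulr0, mul0r, mulr1, normr0, normr1).
- exact: Mk.
have ieTh : ((e i)^-1 * s)%g \in Th k.
  rewrite mem_cat; apply/orP; right.
  by apply: (allpairs_f (fun i s => ((e i)^-1 * s)%g)); rewrite ?mem_iota.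
have [x1 x2] := E_close k c s cA cNA (sTh k s sF).
have [y1 y2] := E_close k c _ cA cNA ieTh.
rewrite /phi mulgA; move: x1 x2 y1 y2.
have := D_ge0 k (s * c)%g; have := D_ge0 k ((e i)^-1 * s * c)%g.
case: (E _); case: (E _); case: (P k _); case: (P k _);
  rewrite ?mulr1 ?mulr0 ?mul0r /=; lra.
Unshelve. all: by end_near. Qed.

End GluingTheorem.

(** * Upper density *)

Section UpperDensity.
Variables (R : realType) (G : groupType) (F : nat -> {fset G}).
Hypothesis folner_F : folner_sequence R F.

Lemma limn_esup_le (u : nat -> \bar R) (m : \bar R) :
  (\forall N \near \oo, (u N <= m)%E) -> (limn_esup u <= m)%E.
Proof.
move=> um; rewrite /limn_esup limf_esupE; apply: ge_ereal_inf.
exists (ereal_sup (u @` [set N | (u N <= m)%E])); first by exists [set N | (u N <= m)%E].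
by apply: ge_ereal_sup => _ [N /= uN <-].
Qed.

Lemma limn_esup_ge (u : nat -> \bar R) (m : \bar R) :
  (forall n, exists2 N, (n <= N)%N & (m <= u N)%E) -> (m <= limn_esup u)%E.
Proof.
move=> mu; rewrite /limn_esup limf_esupE; apply: le_ereal_inf_tmp.
move=> _ [V [n _ nV] <-]; have [N nN mN] := mu n; apply: le_trans mN _.
by apply: ereal_sup_ubound; exists N => //; exact: nV.
Qed.

Lemma limn_esup_gt (u : nat -> \bar R) (m : \bar R) : (m < limn_esup u)%E ->
  forall n, exists2 N, (n <= N)%N & (m < u N)%E.
Proof.
move=> mu n; apply: contrapT => nex; move: mu; rewrite ltNge => /negP; apply.
apply: limn_esup_le; exists n => // N /= nN.
by rewrite leNgt; apply/negP => mN; apply: nex; exists N.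
Qed.

Lemma card_fset_sum (E : set G) N :
  #|` [fset x in F N | x \in E]%fset|%:R = \sum_(x <- F N) (x \in E)%:R :> R.
Proof.
rewrite -natr_sum -[in RHS]big_mkcond sum1_count -size_filter; congr (_%:R).
apply/perm_size/uniq_perm; rewrite ?fset_uniq ?filter_uniq ?fset_uniq // => x.
by rewrite mem_filter !inE andbC.
Qed.

Lemma upper_density_le (E : set G) (m : R) :
  (\forall N \near \oo, \sum_(x <- F N) (x \in E)%:R <= m * #|` F N|%:R) ->
  (upper_density R F E <= m%:E)%E.
Proof.
move=> Em; apply: limn_esup_le; near=> N.
rewrite lee_fin card_fset_sum ler_pdivrMr; last exact: folner_card_gt0.
by near: N.
Unshelve. all: by end_near. Qed.

Lemma upper_density_ge (E : set G) (m : R) :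
  (\forall N \near \oo, m * #|` F N|%:R <= \sum_(x <- F N) (x \in E)%:R) ->
  (m%:E <= upper_density R F E)%E.
Proof.
move=> [n0 _ Em]; apply: limn_esup_ge => n; exists (maxn n n0); first exact: leq_maxl.
rewrite lee_fin card_fset_sum ler_pdivlMr; last exact: folner_card_gt0.
by apply: Em; exact: leq_maxr.
Qed.

Lemma upper_density_le1 E : (upper_density R F E <= 1)%E.
Proof.
apply: upper_density_le; near=> N.
by rewrite -sum_const_fset; apply: ler_sum => x _; case: (_ \in _); rewrite ?ler01.
Unshelve. all: by end_near. Qed.

Lemma upper_density_ge0 E : (0 <= upper_density R F E)%E.
Proof.
apply: upper_density_ge; near=> N.
by rewrite mul0r sumr_ge0.
Unshelve. all: by end_near. Qed.

Lemma mem_ltranslate (g : G) (E : set G) x :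
  (x \in ltranslate g E) = ((g^-1 * x)%g \in E).
Proof.
apply/idP/idP => [/set_mem[y Ey <-]|/set_mem Ex]; apply/mem_set.
  by rewrite mulKg.
by exists (g^-1 * x)%g => //; rewrite mulVKg.
Qed.

(** A point [x] lying in infinitely many [F N] has upper density at least [1 / #|G|] as a singleton,
    while the singleton is disjoint from its translate by any [g] other than [1]. *)
Lemma finite_not_intersective (H : set G) : finite_set [set: G] ->
  H `<=` [set~ 1%g] -> ~ nicely_intersective R F H.
Proof.
move=> finG H1 inter.
have [x xF] : exists x, forall n, exists2 N, (n <= N)%N & x \in F N.
  apply: contrapT => /forallNP nex.
  have nx x : exists n, forall N, (n <= N)%N -> x \notin F N.
    apply: contrapT => /forallNP nn; apply: (nex x) => n.
    apply: contrapT => nN; apply: (nn n) => N le; apply/negP => xF.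
    by apply: nN; exists N.
  have [n nP] := choice nx.
  pose M := \max_(x <- fset_set [set: G]) n x.
  have [y yF] : exists y, y \in F M by apply/fset0Pn; case: folner_F.
  suff le : (n y <= M)%N by have := nP y M le; rewrite yF.
  rewrite /M.
  have yG : y \in fset_set [set: G] by rewrite in_fset_set // in_setT.
  by rewrite (big_rem y) //= leq_maxl.
pose k : R := #|` fset_set [set: G]|%:R.
have cardF N : #|` F N|%:R <= k.
  rewrite ler_nat; apply: fsubset_leq_card; apply/fsubsetP => y _.
  by rewrite in_fset_set // in_setT.
have k0 : 0 < k := lt_le_trans (folner_card_gt0 folner_F 0%N) (cardF 0%N).
have dx : ((k^-1)%:E <= upper_density R F [set x])%E.
  apply: limn_esup_ge => n; have [N nN xN] := xF n; exists N => //.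
  rewrite lee_fin card_fset_sum (big_rem x) //= mem_set // -[leLHS]mul1r.
  apply: ler_pM; rewrite ?invr_ge0 ?(ltW k0) ?ler01 //.
    by rewrite lerDl sumr_ge0.
  by rewrite lef_pV2 // posrE; exact: folner_card_gt0.
have e0 : 0 < k^-1 ^+ 2 by rewrite exprn_gt0 // invr_gt0.
have [g Hg] := inter [set x] _ e0.
have -> : [set x] `&` ltranslate g [set x] = set0.
  apply/seteqP; split=> // y [/= -> [z /= ->]] e.
  by apply: (H1 g Hg); apply: (@mulIg _ x); rewrite mul1g.
apply/negP; rewrite -leNgt.
apply: (@le_trans _ _ 0%E).
  apply: upper_density_le; near=> N.
  by rewrite mul0r big1 // => y _; rewrite in_set0.
rewrite sube_ge0 // EFin_expe.
by rewrite lee_sqr ?upper_density_ge0 // lee_fin invr_ge0 ltW.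
Unshelve. all: by end_near. Qed.

End UpperDensity.

(** * Intersective sets are sets of recurrence *)

Section IntersectiveRecurrence.
Variables (R : realType) (G : groupType) (F : nat -> {fset G}).
Hypotheses (countable_G : countable [set: G]) (folner_F : folner_sequence R F).

(** [eta] and [n] depend on [eps] alone, not on how many elements of [H] are controlled, so one
    glued set violates intersectivity for every element of [H] at once. *)
Lemma correlation_bound_not_intersective (H : set G) (d : measure_display)
    (X : measurableType d) (mu : probability X R) (T : G -> X -> X) (B : set X)
    (H0 : seq G) (delta : R) :
  infinite_set [set: G] -> H `<=` [set~ 1%g] -> H !=set0 -> mp_action mu T ->
  measurable B -> (forall s, s \in H0 -> s != 1%g) -> 0 < delta ->
  delta <= fine (mu B) ^+ 2 ->
  (forall h, H h -> h \notin H0 ->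
     fine (mu (B `&` T h @` B)) <= fine (mu B) ^+ 2 - delta) ->
  ~ nicely_intersective R F H.
Proof.
move=> infG H1 [h0 Hh0] actT mB H01 d0 dB small inter.
have [e He eH] : exists2 e : nat -> G, (forall i, H (e i)) & forall h, H h -> exists i, e i = h.
  have /countable_injP[c cinj] := countable_G.
  exists (fun n => xget h0 [set h | H h /\ c h = n]) => [n|h Hh].
    by case: xgetP => [x _ []|].
  exists (c h); case: xgetP => [x _ /= [_ cx]|/(_ h) []//].
  by apply: cinj; rewrite ?in_setT.
have e1 i : e i != 1%g by apply/eqP; exact: H1.
set b := 4^-1 ^+ size H0 * fine (mu B).
set eps := 16^-1 ^+ size H0 * delta / 16.
have eps0 : 0 < eps by rewrite /eps !mulr_gt0 ?exprn_gt0.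
have /andP[m0 m1] : 0 <= fine (mu B) <= 1.
  rewrite fine_ge0 //= -lee_fin fineK ?fin_num_measure //.
  exact: probability_le1.
have b0 : 0 <= b by rewrite mulr_ge0 ?exprn_ge0.
have b1 : b <= 1.
  by rewrite mulr_ile1 ?exprn_ge0 // exprn_ile1 //; lra.
have epsb : 16 * eps <= b ^+ 2.
  have -> : 16 * eps = 16^-1 ^+ size H0 * delta by rewrite /eps; field.
  rewrite /b exprMn -exprM mulnC exprM.
  have -> : (4^-1 : R) ^+ 2 = 16^-1 by field.
  by rewrite ler_wpM2l ?exprn_ge0.
have b2 : b ^+ 2 <= b by rewrite expr2 ler_piMl.
(* Since [n^-1 <= eta], the losses are [b - D1 <= 12 * eta] and [D2 <= b ^ 2 - eps / 2 + 19 * eta];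
   altogether [43 * eta], within the [3 / 8 * eps] left by the tolerance [eps / 8]. *)
pose eta := eps / 200.
have eta0 : 0 < eta by rewrite divr_gt0.
pose n := (Num.truncn eta^-1).+1.
have n_eta : n%:R^-1 <= eta.
  rewrite -[leRHS]invrK lef_pV2 ?posrE ?invr_gt0 //.
  exact: ltW (truncnS_gt _).
have [P [P1 P2 P3]] := chain actT countable_G infG folner_F mB H01 d0 dB e1
  (fun i => small _ (He i)) eta0 (ltn0Sn (Num.truncn eta^-1)).
rewrite -/n -?/b -?/eps in P1 P2 P3.
have koo i : exists k0, forall k, (k0 <= k)%N -> (i < k %/ n)%N.
  exists (i.+1 * n)%N => k ik; by rewrite leq_divRL.
have P1' m : uniform_ub F (fun g => - (P m g)%:R) (- (b - 2 * eta)).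
  by apply: ub_le (P1 m) => //; rewrite -/b; lra.
have [|||E [E1 E2]] := glue infG folner_F eta0 _ _ _ koo P1' P2 P3.
- by lra.
- by rewrite -/b -/eps; have := sqr_ge0 b; lra.
- by rewrite addr_ge0 ?invr_ge0 // ltW.
have mE x : (x \in [set x | E x]) = E x by apply/idP/idP => [/set_mem|/mem_set].
have etaE : eps = 200 * eta by rewrite /eta; field.
have n0 : 0 <= n%:R^-1 :> R by rewrite invr_ge0.
set D1 := b - 2 * eta - _ - _ in E1.
have D1_ge0 : 0 <= D1 by rewrite /D1; lra.
have dE : (D1%:E <= upper_density R F [set x | E x])%E.
  apply: upper_density_ge => //; near=> N.
  rewrite [leRHS](_ : _ = \sum_(x <- F N) (E x)%:R); last first.
    by apply: eq_bigr => x _; rewrite mE.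
  by near: N.
have e8 : 0 < eps / 8 by rewrite divr_gt0.
have [g Hg] := inter [set x | E x] _ e8.
have [i <-] := eH g Hg; apply/negP; rewrite -leNgt.
set D2 := _ + 6 * _ + _ in E2.
apply: (@le_trans _ _ D2%:E).
  apply: upper_density_le => //; have := E2 i => E2i; near=> N.
  rewrite [leLHS](_ : _ = \sum_(x <- F N) (E x)%:R * (E ((e i)^-1 * x)%g)%:R).
    by near: N.
  by apply: eq_bigr => x _; rewrite in_setI mem_ltranslate !mE -mulnb natrM.
rewrite leeBrDr //; apply: (@le_trans _ _ (D1%:E ^+ 2)%E); last first.
  by rewrite lee_sqr // ?upper_density_ge0 // lee_fin.
rewrite -EFin_expe -EFinD lee_fin.
have tb : (b - D1) * b <= b - D1 by rewrite ler_piMr // /D1; lra.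
have := sqr_ge0 (b - D1); have : b - D1 <= 12 * eta by rewrite /D1; lra.
have -> : D1 ^+ 2 = b ^+ 2 - 2 * ((b - D1) * b) + (b - D1) ^+ 2 by ring.
rewrite /D2; lra.
Unshelve. all: by end_near. Qed.

Lemma intersective_recurrence (H : set G) : H `<=` [set~ 1%g] ->
  nicely_intersective R F H -> nice_recurrence R H.
Proof.
move=> H1 inter d X mu T actT B mB.
have [finG|infG] := pselect (finite_set [set: G]).
  by have := finite_not_intersective folner_F finG H1 inter.
have H_neq0 : H !=set0 by have [g Hg _] := inter set0 1 ltr01; exists g.
apply: le_ereal_inf_tmp => _ [H0 [finH0 H0H] <-].
rewrite leNgt; apply/negP => lt_sup.
pose s0 : seq G := fset_set H0.
have s0P x : (x \in s0) = (x \in H0) by rewrite in_fset_set.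
have s01 x : x \in s0 -> x != 1%g.
  by rewrite s0P => /set_mem/H0H/H1 x1; apply/eqP.
have mBh h : measurable (B `&` T h @` B).
  by apply: measurableI => //; rewrite (mp_image actT); exact: (mp_preimage_measurable actT).
(* If [H] is contained in [H0] the supremum is [-oo]; the whole space with [delta = 1] then meets
   the correlation assumption vacuously. *)
have [[h [Hh hH0]]|noh] := pselect (exists h, H h /\ ~ H0 h); last first.
  apply: (@correlation_bound_not_intersective H d X mu T setT s0 1) => //.
    by rewrite probability_setT /= expr1n.
  move=> h Hh; rewrite s0P => /negP hH0; exfalso; apply: noh; exists h; split=> //.
  by move=> ?; apply: hH0; exact/mem_set.
set s := ereal_sup _ in lt_sup.
have sub h' : H h' -> ~ H0 h' -> (mu (B `&` T h' @` B) <= s)%E.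
  by move=> Hh' nh'; apply: ereal_sup_ubound; exists h'.
have muE : mu B = (fine (mu B))%:E by rewrite fineK ?fin_num_measure.
have s0' : (0 <= s)%E := le_trans (measure_ge0 _ _) (sub h Hh hH0).
have sfin : s \is a fin_num.
  rewrite ge0_fin_numE //; apply: lt_trans lt_sup _.
  by rewrite muE -EFin_expe ltry.
have sE := fineK sfin.
have slt : fine s < fine (mu B) ^+ 2.
  by rewrite -lte_fin sE EFin_expe -muE.
apply: (@correlation_bound_not_intersective H d X mu T B s0
  (fine (mu B) ^+ 2 - fine s)) => //.
- by rewrite subr_gt0.
- by rewrite lerBlDr lerDl fine_ge0.
- move=> h' Hh'; rewrite s0P => /negP nh'; rewrite subKr -lee_fin sE.
  rewrite fineK ?fin_num_measure //; apply: sub => // H0h'.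
  by apply: nh'; exact/mem_set.
Qed.

End IntersectiveRecurrence.

(** * The correspondence principle *)

Section CylinderSets.
Variable V : choiceType.

Definition config := V -> bool.

HB.instance Definition _ := Pointed.on config.

(** The implication is symmetric in [z] and [z'], so membership depends only on the coordinates in
    [D]: these are the clopen sets of the product. *)
Definition cylinder (C : set config) := exists D : seq V,
  forall z z' : config, {in D, z =1 z'} -> C z -> C z'.

Lemma cylinder0 : cylinder set0.
Proof. by exists [::]. Qed.

Lemma cylinderU A B : cylinder A -> cylinder B -> cylinder (A `|` B).
Proof.
move=> [D AD] [D' BD]; exists (D ++ D') => z z' e [Az|Bz]; [left|right].
  by apply: AD Az => v vD; apply: e; rewrite mem_cat vD.
by apply: BD Bz => v vD; apply: e; rewrite mem_cat vD orbT.
Qed.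

Lemma cylinderC A : cylinder A -> cylinder (~` A).
Proof.
move=> [D AD]; exists D => z z' e nAz Az'; apply: nAz.
by apply: AD Az' => v /e.
Qed.

HB.instance Definition _ :=
  @isAlgebraOfSets.Build default_measure_display config cylinder
    cylinder0 cylinderU cylinderC.

(** Otherwise choose points of [A] escaping the first [n] pieces; their pointwise limit lies in [A]
    and escapes every piece. *)
Lemma cylinder_compact (A : set config) (B : nat -> set config) :
  cylinder A -> (forall n, cylinder (B n)) -> A `<=` \bigcup_n B n ->
  exists n, A `<=` \big[setU/set0]_(i < n) B i.
Proof.
move=> [D AD] cB AB; apply: contrapT => /forallNP nex.
have {nex} esc n : exists z, A z /\ forall i, (i < n)%N -> ~ B i z.
  apply: contrapT => nz; apply: (nex n) => z Az; rewrite -bigcup_mkord.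
  apply: contrapT => nB; apply: nz; exists z; split=> // i ni Bz.
  by apply: nB; exists i.
have [zs zsP] := choice esc; have [z zP] := pointwise_limit zs.
have Az : A z by have [m _ mz] := zP D 0%N; apply: AD mz (zsP m).1.
have [k _ Bz] := AB z Az; have [D' BD] := cB k.
have [m km mz] := zP D' k.+1.
by apply: ((zsP m).2 k km); apply: BD Bz => v /mz.
Qed.

End CylinderSets.

Record fin_add (R : realType) (T : Type) := FinAdd {
  fa_val :> set T -> R ;
  fa_ge0 : forall A, 0 <= fa_val A ;
  fa_setT : fa_val setT = 1 ;
  fa_setU : forall A B, A `&` B = set0 -> fa_val (A `|` B) = fa_val A + fa_val B }.

Section FiniteAdditivity.
Variables (R : realType) (T : Type) (p : fin_add R T).

Lemma fa_set0 : p set0 = 0.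
Proof. by have := fa_setU p (setI0 set0); rewrite setU0; lra. Qed.

Lemma fa_mono (A B : set T) : A `<=` B -> p A <= p B.
Proof.
move=> AB; have -> : B = A `|` (B `\` A) by rewrite setDUK.
by rewrite fa_setU ?lerDl ?fa_ge0 // setDIK.
Qed.

Lemma fa_subadd (A B : set T) : p (A `|` B) <= p A + p B.
Proof.
have -> : A `|` B = A `|` (B `\` A) by rewrite setUDr setDv setD0.
by rewrite fa_setU ?setDIK // lerD2l fa_mono // => x [].
Qed.

End FiniteAdditivity.

Section CylinderMeasure.
Variables (R : realType) (V : choiceType).

Definition cyl_content (p : fin_add R (config V)) (C : set (config V)) : \bar R :=
  (p C)%:E.

Variable p : fin_add R (config V).

Let content_ge0 C : (0 <= cyl_content p C)%E.
Proof. by rewrite lee_fin fa_ge0. Qed.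

Let content_semi_additive : measure_function.semi_additive (cyl_content p).
Proof.
move=> B n _ tB _; elim: n => [|n IH].
  by rewrite !big_ord0 /cyl_content fa_set0.
rewrite !big_ord_recr /= -IH /cyl_content fa_setU // -bigcup_mkord.
apply/seteqP; split=> // x [[i /= ni Bi] Bn].
by move: ni; rewrite (tB i n I I) ?ltnn //; exists x.
Qed.

HB.instance Definition _ := isContent.Build _ _ R (cyl_content p)
  content_ge0 content_semi_additive.

(** Compactness reduces countable covers to finite ones, so finite additivity of [p] is enough for
    an extension to a measure. *)
Let content_sigma_subadditive : measurable_subset_sigma_subadditive (cyl_content p).
Proof.
move=> A B cB cA AB; have [n An] := cylinder_compact cA cB AB.
apply: (@le_trans _ _ (\sum_(i < n) cyl_content p (B i))%E).
  apply: (@le_trans _ _ (cyl_content p (\big[setU/set0]_(i < n) B i))).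
    by rewrite lee_fin fa_mono.
  elim: (n) => [|k IH]; first by rewrite !big_ord0 /cyl_content fa_set0.
  rewrite !big_ord_recr /=; apply: le_trans (leeD2r _ IH).
  by rewrite lee_fin fa_subadd.
rewrite -(big_mkord xpredT (fun i => cyl_content p (B i))).
by apply: nneseries_lim_ge => i _ _; exact: content_ge0.
Qed.

HB.instance Definition _ := Content_SigmaSubAdditive_isMeasure.Build _ _ _
  (cyl_content p) content_sigma_subadditive.

End CylinderMeasure.

Definition config_space (V : choiceType) := g_sigma_algebraType (@cylinder V).

Section CylinderProbability.
Variables (R : realType) (V : choiceType).

Definition cyl_measure (p : fin_add R (config V)) :
    set (g_sigma_algebraType (@measurable _ (config V))) -> \bar R :=
  measure_extension (cyl_content p).

HB.instance Definition _ p := Measure.on (cyl_measure p).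

Lemma cyl_measureE p (C : set (config V)) : cylinder C -> cyl_measure p C = (p C)%:E.
Proof. by move=> cC; rewrite /cyl_measure /measure_extension measurable_mu_extE. Qed.

Let cyl_measureT p : cyl_measure p setT = 1%E.
Proof. by rewrite cyl_measureE ?fa_setT //; exists [::]. Qed.

HB.instance Definition _ p := Measure_isProbability.Build _ _ _ (cyl_measure p)
  (cyl_measureT p).

End CylinderProbability.

(** * The shift system *)

Section ShiftSystem.
Variables (R : realType) (G : groupType).

(** Multiplying the argument on the right gives a left action. *)
Definition shift (h : G) (z : config G) : config G := fun g => z (g * h)%g.

Lemma shift1 z : shift 1%g z = z.
Proof. by apply/funext => g; rewrite /shift mulg1. Qed.

Lemma shiftM g h z : shift (g * h)%g z = shift g (shift h z).
Proof. by apply/funext => x; rewrite /shift mulgA. Qed.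

Lemma shift_cylinder h (C : set (config G)) : cylinder C -> cylinder (shift h @^-1` C).
Proof.
move=> [D CD]; exists [seq (g * h)%g | g <- D] => z z' e.
by apply: CD => g gD; apply: e; apply: map_f.
Qed.

Variable p : fin_add R (config G).
Hypothesis p_shift : forall h C, cylinder C -> p (shift h @^-1` C) = p C.

Lemma shift_action : mp_action (cyl_measure p) shift.
Proof.
split=> [|||h A _]; [exact: shift1|exact: shiftM| |].
  pose X : measurableType _ := g_sigma_algebraType (@measurable _ (config G)).
  move=> h; apply: (@measurability _ _ X X setT (shift h) (@measurable _ (config G))) => //.
  move=> _ [C cC <-]; rewrite setTI; apply: sub_sigma_algebra.
  exact: shift_cylinder.
(* A cylinder cover of [B] pulls back to a cover of the preimage with the same total content. This
   gives one inequality for the outer measure; the inverse shift gives the other. *)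
have le h' (B : set (config G)) :
    (cyl_measure p (shift h' @^-1` B) <= cyl_measure p B)%E.
  apply: le_ereal_inf_tmp => _ [C [mC BC] <-]; apply: ge_ereal_inf.
  exists (\sum_(0 <= k <oo) cyl_content p (shift h' @^-1` C k))%E.
    exists (fun k => shift h' @^-1` C k) => //; split=> [i|x Bx].
      exact/shift_cylinder/mC.
    by have [i _ Ci] := BC _ Bx; exists i.
  rewrite le_eqVlt; apply/orP; left; apply/eqP; apply: eq_eseriesr => k _.
  by rewrite /cyl_content p_shift //; exact: mC.
apply/eqP; rewrite eq_le le /=.
have := le h^-1%g (shift h @^-1` A); congr (cyl_measure p _ <= _)%E.
by apply/funext => z; rewrite /preimage /= -shiftM mulgV shift1.
Qed.

End ShiftSystem.

(** * Invariant means from ultrafilters *)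

Section InvariantMean.
Variables (R : realType) (G : groupType) (F : nat -> {fset G}).
Hypothesis folner_F : folner_sequence R F.

Definition density N (A : set G) : R := (\sum_(x <- F N) (x \in A)%:R) / #|` F N|%:R.

Lemma density_ge0 N A : 0 <= density N A.
Proof. by rewrite divr_ge0 // sumr_ge0. Qed.

Lemma density_le1 N A : density N A <= 1.
Proof.
rewrite ler_pdivrMr ?folner_card_gt0 // -sum_const_fset.
by apply: ler_sum => x _; case: (_ \in _); rewrite ?ler01.
Qed.

Variable U : set_system nat.
Hypotheses (ultraU : UltraFilter U) (oo_U : \oo `<=` U).

Let properU : ProperFilter U := ultra_proper.

(** The values lie in the compact interval [[0, 1]], and an ultrafilter converges to any of its
    cluster points. *)
Lemma density_cvg A : cvg (density^~ A @ U).
Proof.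
have [l [_ cl]] : `[0, 1] `&` cluster (density^~ A @ U) !=set0.
  apply: segment_compact.
  have UA : U (density^~ A @^-1` `[0, 1]).
    by apply: filterS filterT => N _; rewrite /= in_itv /= density_ge0 density_le1.
  exact: UA.
apply/cvg_ex; exists l; apply/cvgrPdist_lt => e e0.
have [//|Uc] := in_ultra_setVsetC [set N | `|l - density N A| < e] ultraU.
have [y [yn /= ye]] := cl [set y | ~ `|l - y| < e] (ball l e) Uc (nbhsx_ballx l e e0).
by case: yn.
Qed.

Definition mean (A : set G) : R := lim (density^~ A @ U).

Lemma mean_ge A c : (\forall N \near U, c <= density N A) -> c <= mean A.
Proof. exact: limr_ge (@density_cvg A). Qed.

Lemma mean_le A c : (\forall N \near U, density N A <= c) -> mean A <= c.
Proof. exact: limr_le (@density_cvg A). Qed.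

Lemma mean_setT : mean setT = 1.
Proof.
have dT N : density N setT = 1.
  rewrite /density; under eq_bigr do rewrite in_setT.
  by rewrite sum_const_fset mul1r divff // gt_eqF // folner_card_gt0.
apply/eqP; rewrite eq_le mean_le ?mean_ge //;
  by apply: filterS filterT => N _; rewrite dT.
Qed.

Lemma mean_setU A B : A `&` B = set0 -> mean (A `|` B) = mean A + mean B.
Proof.
move=> AB; rewrite /mean -limD; [|exact: density_cvg|exact: density_cvg].
congr (lim (_ @ U)); apply/funext => N.
rewrite /GRing.add /= /density -mulrDl -big_split /=; congr (_ / _).
apply: eq_bigr => x _; rewrite in_setU.
have [xA|xA] := boolP (x \in A); have [xB|xB] := boolP (x \in B);
  rewrite ?addr0 ?add0r //.
have : (A `&` B) x by split; exact/set_mem.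
by rewrite AB.
Qed.

Definition mean_fin_add : fin_add R G :=
  FinAdd (fun A => mean_ge (filterS (fun N _ => density_ge0 N A) filterT))
    mean_setT mean_setU.

Lemma mean_translate g (A : set G) : mean [set x | A (g * x)%g] = mean A.
Proof.
apply/eqP; rewrite -subr_eq0; apply/eqP.
rewrite /mean -limB; [|exact: density_cvg|exact: density_cvg].
apply/cvg_lim => //; apply/cvgr0Pnorm_le => e e0.
apply: filterS (oo_U (folner_near folner_F [:: g] e0)) => N /(_ g (mem_head _ _)).
have := @folner_shift_sum R G F (fun x => (x \in A)%:R) 1 g N _.
move=> bnd le; rewrite /= -[X in `|X|]/(density N _ - density N A).
rewrite /density -mulrBl normrM normfV [X in _ / X](ger0_norm (ler0n _ _)) ler_pdivrMr ?folner_card_gt0 //.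
apply: le_trans le; rewrite -[leRHS]mul1r.
have -> : \sum_(x <- F N) (x \in [set x0 | A (g * x0)%g])%:R =
    \sum_(x <- F N) ((g * x)%g \in A)%:R :> R by [].
by apply: bnd => x; case: (_ \in _); rewrite ?normr1 ?normr0.
Qed.

(** [U] contains every tail, so the ultralimit is at most the supremum over any tail. *)
Lemma mean_le_upper_density A : ((mean A)%:E <= upper_density R F A)%E.
Proof.
rewrite /upper_density /limn_esup limf_esupE; apply: le_ereal_inf_tmp.
move=> _ [V VU <-]; set s := ereal_sup _.
have bnd N : V N -> ((density N A)%:E <= s)%E.
  by move=> VN; apply: ereal_sup_ubound; exists N => //; rewrite (card_fset_sum R F).
have [N VN] := filter_ex (oo_U VU).
case: s bnd => [s| |] bnd; last 2 first.
- exact: leey.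
- by have := bnd N VN; rewrite leeNy_eq.
rewrite lee_fin; apply: mean_le; apply: filterS (oo_U VU) => M VM.
by rewrite -lee_fin bnd.
Qed.

End InvariantMean.

Lemma recurrence_intersective (R : realType) (G : groupType) (F : nat -> {fset G})
    (H : set G) : folner_sequence R F ->
  nice_recurrence R H -> nicely_intersective R F H.
Proof.
move=> folner_F rec E eps eps0.
have d1 := upper_density_le1 folner_F E.
have d0 := upper_density_ge0 folner_F E.
have dfin : upper_density R F E \is a fin_num.
  by rewrite ge0_fin_numE //; apply: le_lt_trans d1 _; exact: ltry.
pose r := fine (upper_density R F E).
have rE : upper_density R F E = r%:E by rewrite fineK.
have r0 : 0 <= r by rewrite fine_ge0.
have r1 : r <= 1 by rewrite -lee_fin -rE.
have lt_r : ((r - eps / 4)%:E < upper_density R F E)%E.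
  by rewrite rE lte_fin ltrBlDr ltrDl divr_gt0.
(* The ultrafilter must see times at which [E] nearly attains its upper density, so it is taken
   finer than the image of [\oo] under a choice [s] of such times. *)
have sg n : exists N, (n <= N)%N /\ r - eps / 4 <= density R F N E.
  have [N nN] := limn_esup_gt lt_r n.
  by rewrite (card_fset_sum R F) lte_fin => /ltW; exists N.
have [s sP] := choice sg.
have [U [ultraU sU]] := ultraFilterLemma (fmap_proper_filter s eventually_filter).
have oo_U : \oo `<=` U.
  move=> V [n _ nV]; apply: sU; exists n => // N /= nN; apply: nV => /=.
  by apply: leq_trans nN _; have [] := sP N.
pose m := mean_fin_add folner_F ultraU.
(* [phi] intertwines left multiplication by [h] with [shift h] and pulls [B] back to [E]; invariance
   of the mean thus becomes invariance of [p]. *)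
pose phi (x : G) : config G := fun g => (g * x)%g \in E.
pose p : fin_add R (config G) := @FinAdd R (config G) (fun C => m (phi @^-1` C))
  (fun C => fa_ge0 m _) (fa_setT m)
  (fun A B AB => fa_setU m (etrans (esym (preimage_setI phi A B))
     (etrans (congr1 (preimage phi) AB) (preimage_set0 phi)))).
have p_shift h C : cylinder C -> p (shift h @^-1` C) = p C.
  move=> _; rewrite /p /= -(mean_translate folner_F ultraU oo_U h (phi @^-1` C)).
  congr (mean _ _ _); apply/funext => x; rewrite /preimage /=; congr C.
  by apply/funext => g; rewrite /shift /phi mulgA.
have act := shift_action p_shift.
pose B : set (config G) := [set z | z 1%g].
have cB : cylinder B.
  by exists [:: 1%g] => z z' e; rewrite /B /= e // mem_head.
have cBg g : cylinder (B `&` shift g @` B).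
  rewrite (mp_image act); have [D BD] := shift_cylinder g^-1%g cB.
  exists (1%g :: D) => z z' e [Bz Bgz]; split; last first.
    by apply: BD Bgz => v vD; apply: e; rewrite inE vD orbT.
  by move: Bz; rewrite /B /= e // mem_head.
have pB : p B = m E.
  rewrite /p /=; congr (mean _ _ _); apply/seteqP.
  by split=> x; rewrite /preimage /B /phi /= mul1g; [move/set_mem|move/mem_set].
have pBg g : p (B `&` shift g @` B) = m (E `&` ltranslate g E).
  rewrite (mp_image act) /p /=; congr (mean _ _ _); apply/seteqP.
  split=> x; rewrite /preimage /B /phi /shift /= !mul1g.
    by move=> [/set_mem ? gx]; split=> //; apply/set_mem; rewrite mem_ltranslate.
  by move=> [/mem_set ? /mem_set]; rewrite mem_ltranslate.
have mB : @measurable _ (config_space G) B by exact: sub_sigma_algebra.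
have sup_ge : ((m E ^+ 2)%:E <= ereal_sup
    ((fun h => cyl_measure p (B `&` shift h @` B)) @` (H `\` set0)))%E.
  apply: (@le_trans _ _ (cyl_measure p B ^+ 2)%E).
    by rewrite cyl_measureE // pB EFin_expe.
  apply: le_trans (rec _ _ _ _ act B mB) _.
  (* The empty exceptional set is enough: a supremum over all of [H] already yields one suitable
     [g]. *)
  by apply: ereal_inf_lbound; exists set0 => //; split; [exact: finite_set0|].
have mE : r - eps / 4 <= m E.
  have UE : U [set N | r - eps / 4 <= density R F N E].
    by apply: sU; exists 0%N => // n _ /=; have [] := sP n.
  exact: (mean_ge folner_F ultraU UE).
have mE1 : m E <= 1 by rewrite -(fa_setT m) fa_mono.
have lt_sup : ((m E ^+ 2 - eps / 4)%:E < ereal_sup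
    ((fun h => cyl_measure p (B `&` shift h @` B)) @` (H `\` set0)))%E.
  by apply: lt_le_trans sup_ge; rewrite lte_fin ltrBlDr ltrDl divr_gt0.
have [_ [g [Hg _] <-] lt_g] := ereal_sup_gt lt_sup.
exists g => //; apply: (lt_le_trans _ (mean_le_upper_density folner_F ultraU oo_U _)).
rewrite rE -EFin_expe -EFinB lte_fin.
move: lt_g; rewrite cyl_measureE // pBg lte_fin; apply: le_lt_trans.
have m0 := fa_ge0 m E.
(* The total loss is at most [r * eps / 2 + eps / 4], below [eps] because [r <= 1]. *)
have := mulr_ge0 r0 (ltW eps0); nra.
Qed.

Theorem proposition2p9 (R : realType) (G : groupType)
    (countable_G : countable [set: G]) (amenable_G : amenable R G)
    (F : nat -> {fset G}) (folner_F : folner_sequence R F)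
    (H : set G) (H_neq1 : H `<=` [set~ 1%g]) :
  nice_recurrence R H <-> nicely_intersective R F H.
Proof.
split; first exact: recurrence_intersective.
exact: intersective_recurrence.
Qed.
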